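(* Let $m\ge 1$ and $n\ge 2$ be integers. A linear $n$th order system of the form $$\mathbf{y}^{(n)} + B_n^1\,\mathbf{y}^{(n-1)} + \dots + B_n^n\,\mathbf{y} = 0,\qquad \mathbf{y}=\mathbf{y}(x)\in\mathbb{K}^m,$$ where the $B_n^k=B_n^k(x)$ are $m\times m$ matrix functions, is reducible by an invertible point transformation to the canonical form $\mathbf{y}^{(n)}=0$ if and only if its normal form has expression $$0 = \mathbf{w}^{(n)} + A_n^2\, I_m\,\mathbf{w}^{(n-2)} + \dots + A_n^n\, I_m\,\mathbf{w},$$ where $I_m$ is the identity matrix of order $m$ and the $A_n^j = A_n^j(z)$ are scalar functions such that $$0 = w^{(n)} + A_n^2\, w^{(n-2)} + \dots + A_n^n\, w$$ is a scalar linear iterative equation in the dependent variable $w=w(z)$.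
   Context: The base field $\mathbb{K}$ is a field of characteristic zero; coefficient functions are smooth. A point transformation is a change of variables $x=f(z,\mathbf{w})$, $\mathbf{y}=T(z,\mathbf{w})$ with $f$ scalar-valued and $T$ vector-valued, both smooth. Normal form: the normal form of the linear system is the system with leading coefficient the identity matrix and vanishing term of order $n-1$ into which it is transformed by a change of dependent variable $\mathbf{y}=Q\mathbf{w}$, where $Q$ is an invertible matrix function satisfying $B_n^1 Q + nQ'=0$. Iterative scalar equations: for scalar smooth functions $r$ (invertible, i.e. nonvanishing) and $s$ of the independent variable, let $\Psi = r\frac{d}{dz}+s$, so $\Psi[w]=r w'+s w$, and let $\Psi^0=\mathrm{Id}$, $\Psi^n[w]=\Psi^{n-1}[\Psi[w]]$ for $n\ge1$. Write $\Psi^n[w]=K_n^0 w^{(n)}+K_n^1 w^{(n-1)}+\dots+K_n^n w$; here $K_n^0=r^n$ and $K_n^1=r^{n-1}\left(ns+\binom n2 r'\right)$. A scalar linear equation in normal form $w^{(n)}+A_n^2w^{(n-2)}+\dots+A_n^n w=0$ is iterative if there are such $r,s$ with $K_n^1=0$ (equivalently $s=-\tfrac12(n-1)r'$) and $A_n^j=K_n^j/r^n$ for $2\le j\le n$, i.e. if it is $r^{-n}\Psi^n[w]=0$.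
   Formalization: The base field K is taken to be the real or complex numbers, since smooth functions are not defined over an arbitrary field of characteristic zero; point transformations, normal forms and iterative equations are understood locally, near each point of the domain. *)

(* Defs.v *)
From HB Require Import structures.
From mathcomp Require Import all_boot all_order all_algebra.
From mathcomp Require Import all_classical all_reals topology normedtype derive.
From mathcomp Require Import complex.

Set Implicit Arguments.
Unset Strict Implicit.
Unset Printing Implicit Defensive.

Import GRing.Theory numFieldNormedType.Exports.

Local Open Scope ring_scope.
Local Open Scope classical_set_scope.

(* The fields of characteristic zero over which smooth functions have the usual
   calculus.  Over C, derivatives are complex derivatives, so that "smooth"
   means holomorphic. *)
Inductive real_or_complex : numFieldType -> Prop :=
| RealBase (R : realType) : real_or_complex R
| ComplexBase (R : realType) : real_or_complex R[i].

Section Smoothness.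
Context {K : numFieldType} {V W : normedModType K}.

Fixpoint class_C (k : nat) (U : set V) (f : V -> W) : Prop :=
  if k is j.+1 then
    (forall x, U x -> differentiable f x) /\ (forall v, class_C j U ('D_v f))
  else forall x, U x -> {for x, continuous f}.

(* Meaningful for open U, as are all the notions below. *)
Definition smooth_on (U : set V) (f : V -> W) := forall k, class_C k U f.

End Smoothness.

Section Systems.
Context {K : numFieldType} {m : nat}.
Implicit Types (n : nat) (U V : set K) (B A : nat -> K -> 'M[K]_m)
  (y w : K -> 'cV[K]_m).

(* y^(n) + B^1 y^(n-1) + ... + B^n y; only B 1, ..., B n are used. *)
Definition lin_op n B y : K -> 'cV[K]_m := fun x =>
  derive1n n y x + \sum_(1 <= k < n.+1) B k x *m derive1n (n - k) y x.

Definition solves n B U y := forall x, U x -> lin_op n B y x = 0.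

Definition graph U y : set (K * 'cV[K]_m) := [set (x, y x) | x in U].

(* Phi (z, w) = (f (z, w), T (z, w)), with inverse Phi'. *)
Definition invertible_point_transformation
    (Om Om' : set (K * 'cV[K]_m)) (Phi Phi' : K * 'cV[K]_m -> K * 'cV[K]_m) :=
  [/\ open Om, open Om', smooth_on Om Phi & smooth_on Om' Phi'] /\
  [/\ forall p, Om p -> Om' (Phi p), forall q, Om' q -> Om (Phi' q),
      forall p, Om p -> Phi' (Phi p) = p & forall q, Om' q -> Phi (Phi' q) = q].

(* The change of variables (x, y) = Phi (z, w) turns the system with
   coefficients B for y(x) into the system with coefficients A for w(z). *)
Definition transforms n (Om : set (K * 'cV[K]_m))
    (Phi : K * 'cV[K]_m -> K * 'cV[K]_m) B A :=
  forall (U V : set K) w y,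
    open U -> open V -> smooth_on U w -> smooth_on V y ->
    graph U w `<=` Om -> Phi @` graph U w = graph V y ->
    (solves n B V y <-> solves n A U w).

(* Point transformations are local: the system, given on D, is only required to
   be transformed on a neighbourhood of some point above x0. *)
Definition reducible_at n (D : set K) B (x0 : K) :=
  exists (Om Om' : set (K * 'cV[K]_m)) (Phi Phi' : K * 'cV[K]_m -> K * 'cV[K]_m),
    [/\ invertible_point_transformation Om Om' Phi Phi',
        forall q, Om' q -> D q.1,
        exists y0 : 'cV[K]_m, Om' (x0, y0) &
        transforms n Om Phi B (fun _ _ => 0)].

(* The substitution y = Q w turns the left-hand side of the system B into Q
   times that of the system A. *)
Definition normal_form_on n U B A :=
  exists Q : K -> 'M[K]_m,
    [/\ smooth_on U Q,
        forall x, U x -> Q x \in unitmx,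
        forall x, U x -> B 1%N x *m Q x + n%:R *: derive1 Q x = 0,
        forall x, U x -> A 1%N x = 0 &
        forall U' w, open U' -> U' `<=` U -> smooth_on U' w ->
          forall x, U' x ->
            lin_op n B (fun t => Q t *m w t) x = Q x *m lin_op n A w x].

End Systems.

Section Iterative.
Context {K : numFieldType}.
Implicit Types (r s w : K -> K) (n : nat) (U : set K) (a kap : nat -> K -> K).

Definition Psi_op r s w : K -> K := fun z => r z * derive1 w z + s z * w z.

(* The functions kap 0, ..., kap n are the coefficients K_n^0, ..., K_n^n of the
   n-th iterate of Psi_op r s. *)
Definition iter_coefs_on n U r s kap :=
  forall U' w, open U' -> U' `<=` U -> smooth_on U' w ->
    forall z, U' z ->
      iter n (Psi_op r s) w z = \sum_(0 <= j < n.+1) kap j z * derive1n (n - j) w z.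

(* w^(n) + a^2 w^(n-2) + ... + a^n w = 0 is iterative on U *)
Definition iterative_on n U a :=
  exists r s kap,
    [/\ smooth_on U r /\ smooth_on U s,
        forall z, U z -> r z != 0,
        iter_coefs_on n U r s kap,
        forall z, U z -> kap 1%N z = 0 &
        forall j, (2 <= j <= n)%N ->
          forall z, U z -> a j z = kap j z / r z ^+ n].

End Iterative.

(* Main.v *)
From HB Require Import structures.
Require Import Defs.
From mathcomp Require Import all_boot all_order all_algebra.
From mathcomp Require Import all_classical all_reals topology normedtype derive.
From mathcomp Require Import landau.
From mathcomp Require Import ring.
From mathcomp Require Import complex.
Import Order.TTheory GRing.Theory Num.Theory numFieldNormedType.Exports.

(** The two halves rest on two observations.

    A scalar iterative equation is a straightened one in disguise.  If h solves
    r h' + s h = 0 and phi' = 1 / r, then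
       (r d/dx + s)^n (h * (v o phi)) = h * (v^(n) o phi)
    (iter_psi_conj), so w = h * (v o phi) turns the iterative equation into
    v^(n) = 0.  Composed with y = Q w, this gives the point transformation
    (normal_form_reducible).

    Conversely, let a point transformation Phi = (f, T) carry w^(n) = 0 to the
    system.  Nothing forces f to be independent of w, and for n = 2 it need not
    be, but linearising repairs this.  Take a straight line w*(z) along which f
    is not stationary, and disturb it to w* + e (z - c)^i u with i < n.  Each
    disturbed curve still solves w^(n) = 0, hence is mapped to a solution of the
    linear system, and the derivative with respect to e at fixed x of this
    family of solutions is again a solution.  That derivative is
    (z - c)^i P(z) u, where P = T_w - (dT/dz) / (df/dz) f_w is taken along the
    line, and P is invertible because the differential of Phi is
    (reducible_power_solutions).  The linearised transformation therefore
    preserves the fibres and is linear on them: with psi the inverse of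
    z |-> f(z, w*(z)) and M = P o psi, all the columns (psi - c)^i M u solve the
    system.  Put r = 1 / psi', choose s so that the second coefficient of the
    n-th iterate of Psi = r d/dx + s vanishes, let h be a nonvanishing solution
    of Psi h = 0 and Q = M / h.  Expanding the system applied to Q w in the
    iterates Psi^j w and evaluating on w = h (psi - psi x)^j, for which only
    Psi^j w is nonzero at x, kills every term except Q r^-n Psi^n w
    (power_solutions_normal_form).

    The analysis needed for this is local: the mean value inequality, symmetry
    of second derivatives, primitives, the inverse function theorem and first
    order linear equations, all in one variable except the symmetry.  It is
    developed at once for the real and the complex numbers, from convergence
    of geometrically dominated sequences and the archimedean property; in
    particular holomorphic primitives are obtained without path integrals. *)

Set Implicit Arguments.
Unset Strict Implicit.
Unset Printing Implicit Defensive.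

Local Open Scope ring_scope.
Local Open Scope classical_set_scope.

(** * Smooth maps between normed modules *)

Section ClassC.
Context {K : numFieldType}.
Implicit Types V W : normedModType K.

Lemma near_eq_differentiable V W (f g : V -> W) (x : V) :
  (\near x, f x = g x) -> differentiable f x -> differentiable g x.
Proof.
move=> fg df; have fgx := nbhs_singleton fg.
suff H : g \o shift x = cst (g x) + 'd f x +o_ 0 id.
  apply/diff_locallyP; rewrite (diff_unique (diff_continuous df) H); split => //.
  exact: diff_continuous.
apply/eqaddoP => e e0; have /diff_locally /eqaddoP /(_ e e0) := df.
have : \forall h \near 0, f (h + x) = g (h + x).
  by move: fg; rewrite (near_shift 0) /= subr0.
move=> H1 H2; near=> h.
have E : f (h + x) = g (h + x) by near: h.
rewrite -[(_ - _) h]/(g (h + x) - (g x + 'd f x h)) -E -fgx.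
by near: h.
Unshelve. all: by end_near. Qed.

Lemma eq_on_near V W (U : set V) (f g : V -> W) x : open U -> U x ->
  (forall y, U y -> f y = g y) -> \near x, f x = g x.
Proof.
by move=> oU Ux fg; near=> y; apply: fg; near: y; apply: open_nbhs_nbhs.
Unshelve. all: by end_near. Qed.

Lemma class_C_ext V W k (U : set V) (f g : V -> W) : open U ->
  (forall x, U x -> f x = g x) -> class_C k U f -> class_C k U g.
Proof.
move=> oU; elim: k f g => [|k IH] f g fg /=.
  move=> cf x Ux.
  rewrite /prop_for /continuous_at -(fg _ Ux).
  apply: cvg_trans (cf x Ux); apply: near_eq_cvg.
  exact: eq_on_near oU Ux _.
move=> [df Cf]; split=> [x Ux|v].
  by apply: near_eq_differentiable (df x Ux); apply: eq_on_near oU Ux _.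
apply: IH (Cf v) => x Ux; apply: near_eq_derive; exact: eq_on_near oU Ux _.
Qed.

Lemma class_C_sub V W k (U U' : set V) (f : V -> W) : U' `<=` U ->
  class_C k U f -> class_C k U' f.
Proof.
move=> sU; elim: k f => [|k IH] f /=; first by move=> cf x /sU /cf.
by move=> [df Cf]; split=> [x /sU /df|v]; [|exact: IH].
Qed.

Lemma class_CW V W k (U : set V) (f : V -> W) :
  class_C k.+1 U f -> class_C k U f.
Proof.
elim: k f => [|k IH] f [df Cf]; first by move=> x /df /differentiable_continuous.
by split => // v; apply: IH.
Qed.

Lemma class_C_cst V W k (U : set V) (a : W) : class_C k U (fun _ : V => a).
Proof.
elim: k a => [|k IH] a; first by move=> x _; apply: cst_continuous.
split=> [x _|v]; first exact: differentiable_cst.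
have -> : 'D_v (fun _ : V => a) = fun _ => 0 by apply/funext => x; exact: derive_cst.
exact: IH.
Qed.

Lemma class_C_linear V W k (U : set V) (L : {linear V -> W}) : continuous L ->
  class_C k U L.
Proof.
move=> cL; case: k => [|k]; first by move=> x _; apply: cL.
split=> [x _|v]; first exact: linear_differentiable.
have -> : 'D_v L = fun _ => L v.
  by apply/funext => x; rewrite deriveE ?diff_lin//; exact: linear_differentiable.
exact: class_C_cst.
Qed.

Lemma derive_linear V V' W (L : {linear V' -> W}) (f : V -> V') x v :
  continuous L -> differentiable f x -> 'D_v (L \o f) x = L ('D_v f x).
Proof.
move=> cL df; rewrite !deriveE //; last first.
  by apply: differentiable_comp => //; exact: linear_differentiable.
by rewrite diff_comp //=; [rewrite diff_lin|exact: linear_differentiable].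
Qed.

Lemma class_C_lin_comp V V' W k (U : set V) (L : {linear V' -> W}) (f : V -> V') :
  open U -> continuous L -> class_C k U f -> class_C k U (L \o f).
Proof.
move=> oU cL; elim: k f => [|k IH] f.
  by move=> cf x Ux; apply: continuous_comp; [exact: cf|exact: cL].
move=> [df Cf]; split => [x Ux|v].
  by apply: differentiable_comp; [exact: df|exact: linear_differentiable].
apply: class_C_ext oU _ (IH _ (Cf v)) => x Ux /=.
by rewrite derive_linear //; exact: df.
Qed.

Lemma class_CD V W k (U : set V) (f g : V -> W) : open U ->
  class_C k U f -> class_C k U g -> class_C k U (fun x => f x + g x).
Proof.
move=> oU; elim: k f g => [|k IH] f g.
  by move=> cf cg x Ux; apply: continuousD; [exact: cf|exact: cg].
move=> [df Cf] [dg Cg]; split => [x Ux|v].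
  by apply: differentiableD; [exact: df|exact: dg].
apply: class_C_ext oU _ (IH _ _ (Cf v) (Cg v)) => x Ux /=.
by rewrite deriveD //; apply: diff_derivable; [exact: df|exact: dg].
Qed.

Lemma class_C_sum V W (I : Type) (s : seq I) k (U : set V) (f : I -> V -> W) :
  open U -> (forall i, class_C k U (f i)) ->
  class_C k U (fun x => \sum_(i <- s) f i x).
Proof.
move=> oU Cf; elim: s => [|i s IH].
  apply: class_C_ext oU _ (class_C_cst k U (0 : W)) => x _; by rewrite big_nil.
apply: class_C_ext oU _ (class_CD oU (Cf i) IH) => x _; by rewrite big_cons.
Qed.

Lemma class_CM V k (U : set V) (f g : V -> K) : open U ->
  class_C k U f -> class_C k U g -> class_C k U (fun x => f x * g x).
Proof.
move=> oU; elim: k f g => [|k IH] f g.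
  by move=> cf cg x Ux; apply: continuousM; [exact: cf|exact: cg].
move=> Cf0 Cg0; have [df Cf] := Cf0; have [dg Cg] := Cg0; split => [x Ux|v].
  by apply: differentiableM; [exact: df|exact: dg].
apply: class_C_ext oU _ (class_CD oU (IH _ _ (class_CW Cf0) (Cg v)) 
  (IH _ _ (class_CW Cg0) (Cf v))) => x Ux /=.
by rewrite deriveM //; apply: diff_derivable; [exact: df|exact: dg].
Qed.

Lemma class_CZl V W k (U : set V) (f : V -> K) (a : W) : open U ->
  class_C k U f -> class_C k U (fun x => f x *: a).
Proof.
move=> oU Cf.
have cL : continuous (fun x : K => x *: a) by exact: scalel_continuous.
have lin : linear (fun x : K => x *: a) by move=> c u v; rewrite scalerDl scalerA.
pose LM := GRing.isLinear.Build _ _ _ _ _ lin.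
pose L : {linear K -> W} := HB.pack (fun x : K => x *: a) LM.
exact: (@class_C_lin_comp _ _ _ k U L f oU cL Cf).
Qed.

Lemma class_CV V k (U : set V) (f : V -> K) : open U ->
  (forall x, U x -> f x != 0) -> class_C k U f -> class_C k U (fun x => (f x)^-1).
Proof.
move=> oU f0; elim: k f f0 => [|k IH] f f0.
  by move=> cf x Ux; apply: continuousV; [exact: f0|exact: cf].
move=> Cf0; have [df Cf] := Cf0; split => [x Ux|v].
  by apply: differentiableV; [exact: df|exact: f0].
have Cw := class_CM oU (IH _ f0 (class_CW Cf0)) (IH _ f0 (class_CW Cf0)).
apply: class_C_ext oU _
  (class_CM oU (class_C_cst k U (-1 : K)) (class_CM oU Cw (Cf v))) => x Ux /=.
rewrite deriveV ?f0 //; last by apply: diff_derivable; exact: df.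
by rewrite [RHS]scaleNr mulN1r expr2 invfM.
Qed.

(** Finite systems of continuous linear coordinates.  They let every statement
    about maps into or out of a product or a space of matrices be checked on
    scalar functions. *)
Record frame V := Frame {
  fr_idx : finType;
  fr_vec : fr_idx -> V;
  fr_crd : fr_idx -> {linear V -> K};
  fr_cont : forall i, continuous (fr_crd i);
  fr_sum : forall v, v = \sum_i fr_crd i v *: fr_vec i }.
Arguments fr_vec {V} f i.
Arguments fr_crd {V} f i.
Arguments fr_cont {V} f i.

Lemma class_C_frame V W (F : frame W) k (U : set V) (f : V -> W) : open U ->
  (forall i, class_C k U (fr_crd F i \o f)) -> class_C k U f.
Proof.
move=> oU Cf.
have := @class_C_sum V W (fr_idx F) (index_enum (fr_idx F)) k U
  (fun i x => fr_crd F i (f x) *: fr_vec F i) oU.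
move=> H; apply: (class_C_ext oU _ (H _)) => [x Ux|i].
  by rewrite -fr_sum.
exact: (@class_CZl V W k U (fr_crd F i \o f)).
Qed.

Lemma derive_frame V V' W (F : frame V') (f : V -> V') (g : V' -> W) x v :
  differentiable f x -> differentiable g (f x) ->
  'D_v (g \o f) x = \sum_i fr_crd F i ('D_v f x) *: 'D_(fr_vec F i) g (f x).
Proof.
move=> df dg; rewrite deriveE; last exact: differentiable_comp.
rewrite diff_comp // [_ v]/= [X in 'd _ _ X](fr_sum F) linear_sum.
by apply: eq_bigr => i _; rewrite linearZ /= !deriveE.
Qed.

(** The chain rule in coordinates writes the derivative of the composite as a
    sum of products of a coordinate of 'D_v f with a directional derivative of g
    composed with f, so the induction on the order can range over all g while
    f stays the same. *)
Lemma class_C_comp V V' W (F : frame V') k (U : set V) (U' : set V')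
    (f : V -> V') (g : V' -> W) (FW : frame W) :
  open U -> open U' ->
  (forall x, U x -> U' (f x)) ->
  class_C k U f -> class_C k U' g -> class_C k U (g \o f).
Proof.
move=> oU oU' ff'.
have scal (h : V' -> K) : class_C k U f -> class_C k U' h -> class_C k U (h \o f).
  elim: k h => [|k IH] h.
    by move=> cf cg x Ux; apply: continuous_comp; [exact: cf|apply: cg; exact: ff'].
  move=> Cf0 Cg0; have [df Cf] := Cf0; have [dg Cg] := Cg0; split => [x Ux|v].
    by apply: differentiable_comp; [exact: df|apply: dg; exact: ff'].
  have H := @class_C_sum V K (fr_idx F) (index_enum (fr_idx F)) k U
    (fun i x => (fr_crd F i ('D_v f x) * ('D_(fr_vec F i) h \o f) x)) oU.
  apply: (class_C_ext oU _ (H _)) => [x Ux|i].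
    by rewrite (derive_frame F) //; [exact: df|apply: dg; exact: ff'].
  apply: class_CM => //.
    exact: (class_C_lin_comp oU (fr_cont F i) (Cf v)).
  by apply: IH; [exact: class_CW|exact: Cg].
move=> Cf Cg; apply: (class_C_frame (F := FW)) => // i.
apply: (scal (fr_crd FW i \o g)) => //.
exact: (class_C_lin_comp oU' (fr_cont FW i) Cg).
Qed.

End ClassC.

Arguments fr_vec {K V} f i.
Arguments fr_crd {K V} f i.
Arguments fr_cont {K V} f i.

Section Frames.
Context {K : numFieldType}.
Implicit Types V W : normedModType K.

Fact frameK_sum (v : K) : v = \sum_(i : unit) (idfun : {linear K -> K}) v *: (1 : K).
Proof. by rewrite big_const card_unit /= addr0 /GRing.scale /= mulr1. Qed.

Fact frameK_cont (i : unit) : continuous (idfun : {linear K -> K}).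
Proof. by move=> x. Qed.

Definition frameK : frame K := Frame frameK_cont frameK_sum.

Definition entry m p (i : 'I_m) (j : 'I_p) (M : 'M[K]_(m, p)) : K := M i j.

Fact entry_linear m p (i : 'I_m) (j : 'I_p) : linear (@entry m p i j).
Proof. by move=> a u v; rewrite /entry !mxE. Qed.
HB.instance Definition _ m p (i : 'I_m) (j : 'I_p) :=
  GRing.isLinear.Build K 'M[K]_(m, p) K _ (entry i j) (entry_linear i j).

Fact frameM_sum m p (v : 'M[K]_(m, p)) :
  v = \sum_(i : 'I_m * 'I_p) entry i.1 i.2 v *: delta_mx i.1 i.2.
Proof.
rewrite [LHS]matrix_sum_delta.
by rewrite (pair_bigA _ (fun i j => v i j *: delta_mx i j)).
Qed.

Fact frameM_cont m p (i : 'I_m * 'I_p) :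
  continuous (entry i.1 i.2 : {linear 'M[K]_(m, p) -> K}).
Proof. exact: coord_continuous. Qed.

Definition frameM m p : frame 'M[K]_(m, p) :=
  Frame (@frameM_cont m p) (@frameM_sum m p).

Definition pair_coord V W (F : frame V) (G : frame W) (i : fr_idx F + fr_idx G)
    (p : V * W) : K :=
  match i with inl i => fr_crd F i p.1 | inr j => fr_crd G j p.2 end.

Fact pair_coord_linear V W (F : frame V) (G : frame W) i :
  linear (@pair_coord V W F G i).
Proof. by case: i => i a u v /=; rewrite linearP. Qed.
HB.instance Definition _ V W (F : frame V) (G : frame W) i :=
  GRing.isLinear.Build K (V * W)%type K _ (@pair_coord V W F G i)
    (pair_coord_linear i).

Fact pair_coord_cont V W (F : frame V) (G : frame W) i :
  continuous (@pair_coord V W F G i : {linear (V * W)%type -> K}).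
Proof.
case: i => i /= x.
  exact: (@continuous_comp _ _ _ fst (fr_crd F i) x (@cvg_fst _ _ _ _ _) (fr_cont F i _)).
exact: (@continuous_comp _ _ _ snd (fr_crd G i) x (@cvg_snd _ _ _ _ _) (fr_cont G i _)).
Qed.

Fact framep_sum V W (F : frame V) (G : frame W) (v : V * W) :
  v = \sum_(i : fr_idx F + fr_idx G) @pair_coord V W F G i v *:
    match i with inl i => (fr_vec F i, 0) | inr j => (0, fr_vec G j) end.
Proof.
rewrite big_sumType /=; case: v => v w.
rewrite -[LHS]/(v, w); apply: injective_projections => /=.
  rewrite raddf_sum raddf_sum /= [X in _ = _ + X]big1 ?addr0; last first.
    by move=> j _; rewrite scaler0.
  exact: fr_sum.
rewrite raddf_sum raddf_sum /= [X in _ = X + _]big1 ?add0r; last first.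
  by move=> j _; rewrite scaler0.
exact: fr_sum.
Qed.

Definition framep V W (F : frame V) (G : frame W) : frame (V * W)%type :=
  Frame (@pair_coord_cont V W F G) (@framep_sum V W F G).

End Frames.

Section SmoothOn.
Context {K : numFieldType}.
Implicit Types V W : normedModType K.

Section Generic.
Context {V : normedModType K} (U : set V) (oU : open U).

Lemma smooth_ext W (f g : V -> W) :
  (forall x, U x -> f x = g x) -> smooth_on U f -> smooth_on U g.
Proof. by move=> fg sf k; apply: class_C_ext fg (sf k). Qed.

Lemma smooth_sub W (U' : set V) (f : V -> W) : U' `<=` U ->
  smooth_on U f -> smooth_on U' f.
Proof. by move=> sU sf k; apply: class_C_sub sU (sf k). Qed.

Lemma smooth_diff W (f : V -> W) x : smooth_on U f -> U x -> differentiable f x.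
Proof. by move=> sf; have [df _] := sf 1%N; apply: df. Qed.

Lemma smooth_derive W (f : V -> W) v : smooth_on U f -> smooth_on U ('D_v f).
Proof. by move=> sf k; have [_] := sf k.+1; apply. Qed.

Lemma smooth_cont W (f : V -> W) x : smooth_on U f -> U x -> {for x, continuous f}.
Proof. by move=> sf Ux; apply: (sf 0%N). Qed.

Lemma smooth_cst W (a : W) : smooth_on U (fun=> a).
Proof. by move=> k; exact: class_C_cst. Qed.

Lemma smooth_linear W (L : {linear V -> W}) : continuous L -> smooth_on U L.
Proof. by move=> cL k; exact: class_C_linear. Qed.

Lemma smooth_linear_comp V' W (L : {linear V' -> W}) (f : V -> V') :
  continuous L -> smooth_on U f -> smooth_on U (L \o f).
Proof. by move=> cL sf k; exact: class_C_lin_comp. Qed.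

Lemma smoothD W (f g : V -> W) :
  smooth_on U f -> smooth_on U g -> smooth_on U (fun x => f x + g x).
Proof. by move=> sf sg k; exact: class_CD. Qed.

Lemma smooth_sum W (I : Type) (s : seq I) (f : I -> V -> W) :
  (forall i, smooth_on U (f i)) -> smooth_on U (fun x => \sum_(i <- s) f i x).
Proof. by move=> sf k; apply: class_C_sum => // i; exact: sf. Qed.

Lemma smoothM (f g : V -> K) :
  smooth_on U f -> smooth_on U g -> smooth_on U (fun x => f x * g x).
Proof. by move=> sf sg k; exact: class_CM. Qed.

Lemma smoothN (f : V -> K) : smooth_on U f -> smooth_on U (fun x => - f x).
Proof.
move=> sf; apply: smooth_ext (smoothM (smooth_cst (-1 : K)) sf) => x _.
by rewrite mulN1r.
Qed.

Lemma smoothB (f g : V -> K) :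
  smooth_on U f -> smooth_on U g -> smooth_on U (fun x => f x - g x).
Proof. by move=> sf sg; apply: smoothD => //; exact: smoothN. Qed.

Lemma smoothV (f : V -> K) : (forall x, U x -> f x != 0) ->
  smooth_on U f -> smooth_on U (fun x => (f x)^-1).
Proof. by move=> f0 sf k; exact: class_CV. Qed.

Lemma smoothX (f : V -> K) n : smooth_on U f -> smooth_on U (fun x => f x ^+ n).
Proof.
move=> sf; elim: n => [|n IH]; first exact: smooth_cst.
by apply: smooth_ext (smoothM sf IH) => x _; rewrite exprS.
Qed.

Lemma smoothZl W (f : V -> K) (a : W) :
  smooth_on U f -> smooth_on U (fun x => f x *: a).
Proof. by move=> sf k; exact: class_CZl. Qed.

Lemma smooth_frame W (F : frame W) (f : V -> W) :
  (forall i, smooth_on U (fr_crd F i \o f)) -> smooth_on U f.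
Proof. by move=> sf k; apply: (@class_C_frame _ _ _ F) => // i; exact: sf. Qed.

Lemma smooth_comp V' W (F : frame V') (FW : frame W) (U' : set V')
    (f : V -> V') (g : V' -> W) : open U' -> (forall x, U x -> U' (f x)) ->
  smooth_on U f -> smooth_on U' g -> smooth_on U (g \o f).
Proof. by move=> oU' ff' sf sg k; apply: (@class_C_comp K V V' W F k U U'). Qed.

Lemma smooth_entry m p (M : V -> 'M[K]_(m, p)) i j :
  smooth_on U M -> smooth_on U (fun x => M x i j).
Proof.
move=> sM; apply: (@smooth_linear_comp _ _ (entry i j)) => //.
exact: coord_continuous.
Qed.

Lemma smooth_mx m p (M : V -> 'M[K]_(m, p)) :
  (forall i j, smooth_on U (fun x => M x i j)) -> smooth_on U M.
Proof. by move=> sM; apply: (@smooth_frame _ (frameM m p)) => i; exact: sM. Qed.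

Lemma smooth_fst V' W (f : V -> V' * W) : smooth_on U f -> smooth_on U (fun x => (f x).1).
Proof.
move=> sf; apply: (@smooth_linear_comp _ _ (@fst V' W : {linear (V' * W)%type -> V'})) => // x.
exact: cvg_fst.
Qed.

Lemma smooth_snd V' W (f : V -> V' * W) : smooth_on U f -> smooth_on U (fun x => (f x).2).
Proof.
move=> sf; apply: (@smooth_linear_comp _ _ (@snd V' W : {linear (V' * W)%type -> W})) => // x.
exact: cvg_snd.
Qed.

Lemma smooth_pair V' W (F : frame V') (G : frame W) (f : V -> V') (g : V -> W) :
  smooth_on U f -> smooth_on U g -> smooth_on U (fun x => (f x, g x)).
Proof.
move=> sf sg; apply: (@smooth_frame _ (framep F G)) => -[i|i].
  by apply: (@smooth_linear_comp _ _ (fr_crd F i)) => //; exact: fr_cont.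
by apply: (@smooth_linear_comp _ _ (fr_crd G i)) => //; exact: fr_cont.
Qed.

End Generic.

Lemma smooth_on_fst V W (X : set (V * W)) : smooth_on X (fun p => p.1).
Proof.
apply: (@smooth_linear _ _ _ (@fst V W : {linear (V * W)%type -> V})) => p.
exact: cvg_fst.
Qed.

Lemma smooth_on_snd V W (X : set (V * W)) : smooth_on X (fun p => p.2).
Proof.
apply: (@smooth_linear _ _ _ (@snd V W : {linear (V * W)%type -> W})) => p.
exact: cvg_snd.
Qed.

Section DirectionalRules.
Context {V : normedModType K}.
Implicit Types (f g : V -> K) (x v : V).

Lemma Dv_add f g x v : differentiable f x -> differentiable g x ->
  'D_v (fun y => f y + g y) x = 'D_v f x + 'D_v g x.
Proof. by move=> df dg; apply: deriveD; exact: diff_derivable. Qed.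

Lemma Dv_mul f g x v : differentiable f x -> differentiable g x ->
  'D_v (fun y => f y * g y) x = 'D_v f x * g x + f x * 'D_v g x.
Proof.
move=> df dg; rewrite -[fun y => _]/(f * g) deriveM; try exact: diff_derivable.
by rewrite /GRing.scale /= addrC mulrC.
Qed.

Lemma Dv_inv f x v : f x != 0 -> differentiable f x ->
  'D_v (fun y => (f y)^-1) x = - 'D_v f x / f x ^+ 2.
Proof.
move=> f0 df; rewrite deriveV //; last exact: diff_derivable.
by rewrite /GRing.scale /= mulNr mulNr mulrC.
Qed.

Lemma diff_sum (I : Type) (s : seq I) (f : I -> V -> K) x :
  (forall i, differentiable (f i) x) ->
  differentiable (fun y => \sum_(i <- s) f i y) x.
Proof.
move=> df; elim: s => [|i s IH].
  have -> : (fun y => \sum_(i <- [::]) f i y) = fun=> 0.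
    by apply/funext => y; rewrite big_nil.
  exact: differentiable_cst.
have -> : (fun y => \sum_(j <- i :: s) f j y) = f i + (fun y => \sum_(j <- s) f j y).
  by apply/funext => y; rewrite big_cons.
exact: differentiableD.
Qed.

Lemma Dv_sum (I : Type) (s : seq I) (f : I -> V -> K) x v :
  (forall i, differentiable (f i) x) ->
  'D_v (fun y => \sum_(i <- s) f i y) x = \sum_(i <- s) 'D_v (f i) x.
Proof.
move=> df; elim: s => [|i s IH].
  have -> : (fun y => \sum_(i <- [::]) f i y) = fun=> 0.
    by apply/funext => y; rewrite big_nil.
  by rewrite big_nil derive_cst.
rewrite big_cons -IH -Dv_add //; last exact: diff_sum.
by congr (derive _ x v); apply/funext => y; rewrite big_cons.
Qed.

Lemma Dv_chain (g : K -> K) f x v : differentiable f x -> differentiable g (f x) ->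
  'D_v (fun y => g (f y)) x = derive1 g (f x) * 'D_v f x.
Proof.
move=> df dg; rewrite -[fun y => _]/(g \o f) !deriveE //; last exact: differentiable_comp.
by rewrite diff_comp //= diff1E // mulrC.
Qed.

End DirectionalRules.

Section OneVariable.
Implicit Types (f g : K -> K) (U : set K) (x : K).

Lemma d1_add f g x : differentiable f x -> differentiable g x ->
  derive1 (fun y => f y + g y) x = derive1 f x + derive1 g x.
Proof. by rewrite !derive1E; exact: Dv_add. Qed.

Lemma d1_mul f g x : differentiable f x -> differentiable g x ->
  derive1 (fun y => f y * g y) x = derive1 f x * g x + f x * derive1 g x.
Proof. by rewrite !derive1E; exact: Dv_mul. Qed.

Lemma d1_chain f g x : differentiable f x -> differentiable g (f x) ->
  derive1 (fun y => g (f y)) x = derive1 g (f x) * derive1 f x.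
Proof. by move=> df dg; rewrite derive1E Dv_chain // !derive1E. Qed.

Lemma d1_cst (a : K) x : derive1 (fun=> a) x = 0.
Proof. exact: derive1_cst. Qed.

Lemma d1_id x : derive1 (fun y : K => y) x = 1.
Proof. by rewrite derive1E derive_id. Qed.

Lemma d1_ext (W : normedModType K) U (f g : K -> W) x : open U -> U x ->
  (forall y, U y -> f y = g y) ->
  derive1 f x = derive1 g x.
Proof.
move=> oU Ux fg; rewrite !derive1E; apply: near_eq_derive; exact: eq_on_near oU Ux fg.
Qed.

Lemma dn_ext (W : normedModType K) U (f g : K -> W) k : open U ->
  (forall y, U y -> f y = g y) ->
  forall x, U x -> derive1n k f x = derive1n k g x.
Proof.
move=> oU; elim: k f g => [|k IH] f g fg x Ux; first exact: fg.
by rewrite !derive1nS; apply: d1_ext (Ux) _ => // y; apply: IH.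
Qed.

Lemma smooth_d1 (W : normedModType K) U (f : K -> W) : open U ->
  smooth_on U f -> smooth_on U (derive1 f).
Proof.
move=> oU sf; apply: (smooth_ext oU _ (smooth_derive (1 : K) sf)) => x _.
by rewrite derive1E.
Qed.

Lemma smooth_dn (W : normedModType K) U (f : K -> W) k : open U ->
  smooth_on U f -> smooth_on U (derive1n k f).
Proof.
move=> oU sf; elim: k => [//|k IH]; rewrite derive1nS; exact: smooth_d1.
Qed.

Lemma smooth_id U : smooth_on U (fun y : K => y).
Proof. by apply: (@smooth_linear _ _ _ (idfun : {linear K -> K})) => x. Qed.

(** A function of one variable is smooth as soon as its derivative is. *)
Lemma smooth_of_d1 U f : open U -> (forall x, U x -> differentiable f x) ->
  smooth_on U (derive1 f) -> smooth_on U f.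
Proof.
move=> oU df sf [|k]; first by move=> x /df /differentiable_continuous.
split=> // v; apply: class_C_ext oU _ (class_CM oU (class_C_cst k U v) (sf k)) => x Ux.
by rewrite deriveE ?diff1E //; exact: df.
Qed.

End OneVariable.
End SmoothOn.

(** * Calculus over the real and the complex numbers *)

(** The archimedean property together with convergence of the sequences whose
    steps are dominated by a geometric progression.  It is stated with norms
    only, and it is all that the analysis below uses of the base field. *)
Definition geometrically_complete (K : numFieldType) :=
  (forall x e : K, 0 < e -> exists k, `|x| < e * 2 ^+ k) /\
  (forall (u : nat -> K) (C : K),
     (forall k, `|u k.+1 - u k| <= C / 2 ^+ k) ->
     exists l, forall k, `|u k - l| <= 4 * C / 2 ^+ k).

Section GeometricR.
Variable R : realType.

(** The intervals of radius 2 C / 2 ^ k about u k are nested, and the limit is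
    the supremum of their left endpoints. *)
Lemma geometric_limit_real (u : nat -> R) (C : R) :
  (forall k, `|u k.+1 - u k| <= C / 2 ^+ k) ->
  exists l, forall k, `|u k - l| <= 2 * C / 2 ^+ k.
Proof.
move=> uC; pose a k := u k - 2 * C / 2 ^+ k; pose b k := u k + 2 * C / 2 ^+ k.
have C0 : 0 <= C by have := le_trans (normr_ge0 _) (uC 0%N); rewrite expr0 divr1.
have half k : 2 * C / 2 ^+ k.+1 = C / 2 ^+ k.
  by rewrite exprS; field; rewrite expf_neq0 // pnatr_eq0.
have a_mono i j : (i <= j)%N -> a i <= a j.
  elim: j => [|j IH]; first by rewrite leqn0 => /eqP ->.
  rewrite leq_eqVlt => /predU1P[-> //|/IH /le_trans]; apply.
  have := uC j; rewrite ler_distl => /andP[H _].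
  rewrite /a half; apply: le_trans (lerB H (lexx _)).
  by rewrite -mulrA mulr2n mulrDl mul1r opprD addrA.
have b_mono i j : (i <= j)%N -> b j <= b i.
  elim: j => [|j IH]; first by rewrite leqn0 => /eqP ->.
  rewrite leq_eqVlt => /predU1P[-> //|/IH]; apply: le_trans.
  have := uC j; rewrite ler_distl => /andP[_ H].
  rewrite /b half; apply: le_trans (lerD H (lexx _)) _.
  by rewrite -[2 * C / _]mulrA mulr2n mulrDl mul1r addrA.
have ab k : a k <= b k.
  by rewrite lerD2l -subr_ge0 opprK addr_ge0 // divr_ge0 ?exprn_ge0 ?mulr_ge0.
have aib i j : a i <= b j.
  apply: le_trans (a_mono _ _ (leq_maxl i j)) _.
  exact: le_trans (ab _) (b_mono _ _ (leq_maxr i j)).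
pose S := range a; have S0 : S !=set0 by exists (a 0%N), 0%N.
have Sub j : ubound S (b j) by move=> _ [i _ <-].
exists (sup S) => k; rewrite ler_distl; apply/andP; split.
  rewrite lerBlDr; apply: ge_sup => //; exact: Sub.
rewrite -lerBlDr; apply: ub_le_sup; [by exists (b 0%N); exact: Sub|by exists k].
Qed.

Lemma geometrically_complete_real : geometrically_complete R.
Proof.
split=> [x e e0|u C uC].
  exists (Num.bound (`|x| / e)); rewrite mulrC -ltr_pdivrMr //.
  apply: lt_le_trans (archi_boundP _) _; first by rewrite divr_ge0 // ltW.
  by rewrite -natrX ler_nat ltnW // ltn_expl.
have [l lP] := geometric_limit_real uC; exists l => k; apply: le_trans (lP k) _.
have C0 : 0 <= C by have := le_trans (normr_ge0 _) (uC 0%N); rewrite expr0 divr1.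
by rewrite ler_wpM2r ?invr_ge0 ?exprn_ge0 // ler_wpM2r // ler_nat.
Qed.

End GeometricR.

Section GeometricC.
Variable R : realType.
Local Open Scope complex_scope.

Lemma geometrically_complete_complex : geometrically_complete R[i].
Proof.
have [arch _] := geometrically_complete_real R.
have nrm (z : R[i]) : `|z| = (complex.Re `|z|)%:C by case: z => a b.
have re_le (z : R[i]) : `|complex.Re z| <= complex.Re `|z|.
  case: z => a b /=; rewrite -sqrtr_sqr ler_wsqrtr // lerDl; exact: sqr_ge0.
have im_le (z : R[i]) : `|complex.Im z| <= complex.Re `|z|.
  case: z => a b /=; rewrite -sqrtr_sqr ler_wsqrtr // lerDr; exact: sqr_ge0.
have pow k : (2 : R[i]) ^+ k = (2 ^+ k)%:C by rewrite rmorphXn /= rmorph_nat.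
split=> [x e e0|u C uC].
  have eE : e = (complex.Re e)%:C by rewrite {1}(complexE e) ger0_Im ?ltW // mulr0 addr0.
  have e1 : 0 < complex.Re e by move: e0; rewrite {1}eE ltcR.
  have [k Hk] := arch (complex.Re `|x|) _ e1; exists k.
  rewrite eE pow -rmorphM nrm ltcR; apply: le_lt_trans Hk; exact: ler_norm.
have C0 : 0 <= C by have := le_trans (normr_ge0 _) (uC 0%N); rewrite expr0 divr1.
have CE : C = (complex.Re C)%:C by rewrite {1}(complexE C) ger0_Im // mulr0 addr0.
have uC' k : complex.Re `|u k.+1 - u k| <= complex.Re C / 2 ^+ k.
  have := uC k; rewrite {1}CE pow -fmorphV -rmorphM (nrm (u k.+1 - u k)).
  by rewrite lecR.
have reB (z w : R[i]) : complex.Re (z - w) = complex.Re z - complex.Re w.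
  by case: z w => [a b] [c d].
have imB (z w : R[i]) : complex.Im (z - w) = complex.Im z - complex.Im w.
  by case: z w => [a b] [c d].
have [lr lrP] : exists l, forall k, `|complex.Re (u k) - l| <= 2 * complex.Re C / 2 ^+ k.
  by apply: geometric_limit_real => k; rewrite -reB; apply: le_trans (re_le _) (uC' k).
have [li liP] : exists l, forall k, `|complex.Im (u k) - l| <= 2 * complex.Re C / 2 ^+ k.
  by apply: geometric_limit_real => k; rewrite -imB; apply: le_trans (im_le _) (uC' k).
have nle (z : R[i]) : complex.Re `|z| <= `|complex.Re z| + `|complex.Im z|.
  case: z => a b /=; rewrite -[leRHS]ger0_norm ?addr_ge0 // -sqrtr_sqr ler_wsqrtr //.
  by rewrite sqrrD !real_normK ?num_real // lerD2r lerDl mulrn_wge0 // mulr_ge0.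
exists (lr +i* li) => k.
have -> : 4 * C / 2 ^+ k = (4 * complex.Re C / 2 ^+ k)%:C.
  by rewrite {1}CE pow !rmorphM fmorphV /= rmorph_nat.
rewrite nrm lecR; apply: le_trans (nle _) _; rewrite reB imB /=.
apply: le_trans (lerD (lrP k) (liP k)) _.
by rewrite -mulrDl -mulrDl -natrD.
Qed.

End GeometricC.

Lemma real_or_complex_complete (K : numFieldType) :
  real_or_complex K -> geometrically_complete K.
Proof.
case=> R; [exact: geometrically_complete_real|exact: geometrically_complete_complex].
Qed.

Section EpsilonDelta.
Variable K : numFieldType.
Implicit Types (f : K -> K) (c A : K).

Lemma differentiable_eps f c e : differentiable f c -> 0 < e ->
  exists2 d, 0 < d & forall x, `|x - c| < d ->
    `|f x - f c - derive1 f c * (x - c)| <= e * `|x - c|.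
Proof.
move=> df e0; have /diff_locally /eqaddoP /(_ e e0) := df.
rewrite diff1E // => /nbhs_ballP [d /= d0 H]; exists d => // x xc.
have := H (x - c); rewrite -ball_normE /= sub0r normrN => /(_ xc).
rewrite -[(_ - _) (x - c)]/(f (x - c + c) - (f c + (x - c) * derive1 f c)).
by rewrite subrK opprD addrA [_ * (x - c)]mulrC.
Qed.

Lemma eps_differentiable f c A :
  (forall e, 0 < e -> exists2 d, 0 < d & forall x, `|x - c| < d ->
    `|f x - f c - A * (x - c)| <= e * `|x - c|) ->
  differentiable f c /\ derive1 f c = A.
Proof.
move=> H; pose L := fun h : K => h *: (A : K).
have lin : linear L by move=> a u v; rewrite /L scalerDl scalerA.
pose LM := GRing.isLinear.Build _ _ _ _ _ lin.
pose LL : {linear K -> K} := HB.pack L LM.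
have cL : continuous LL by exact: scalel_continuous.
have E : f \o shift c = cst (f c) + LL +o_ 0 id.
  apply/eqaddoP => e /H [d d0 Hd]; apply/nbhs_ballP; exists d => //= h.
  rewrite -ball_normE /= sub0r normrN => hd.
  rewrite -[(_ - _) h]/(f (h + c) - (f c + h * A)).
  have := Hd (h + c); rewrite addrK => /(_ hd).
  by rewrite opprD addrA [A * h]mulrC.
have dE := diff_unique cL E.
have df : differentiable f c by apply/diff_locallyP; rewrite dE; split.
by split => //; rewrite derive1E' // dE /= /L scale1r.
Qed.

Lemma continuous_eps (V : normedModType K) (f : V -> K) (c : V) (e : K) :
  {for c, continuous f} -> 0 < e ->
  exists2 d, 0 < d & forall x, `|x - c| < d -> `|f x - f c| < e.
Proof.
move=> cf e0; have /cvgrPdist_lt /(_ e e0) := cf.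
move=> /nbhs_ballP [d /= d0 H]; exists d => // x xc.
by have := H x; rewrite -ball_normE /= distrC => /(_ xc); rewrite distrC.
Qed.

Lemma open_eps (V : normedModType K) (U : set V) (c : V) : open U -> U c ->
  exists2 d : K, 0 < d & forall x, `|x - c| < d -> U x.
Proof.
move=> oU Uc; have /nbhs_ballP [d /= d0 H] := open_nbhs_nbhs (conj oU Uc).
by exists d => // x xc; apply: H; rewrite -ball_normE /= distrC.
Qed.

Lemma eps_open (V : normedModType K) (U : set V) :
  (forall c : V, U c -> exists2 d : K, 0 < d & forall x, `|x - c| < d -> U x) -> open U.
Proof.
move=> H; rewrite openE => c /H [d d0 Hd]; apply/nbhs_ballP; exists d => // x.
by rewrite -ball_normE /= distrC; exact: Hd.
Qed.

Lemma open_norm_ball (V : normedModType K) (c : V) (d : K) :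
  open [set x | `|x - c| < d].
Proof.
apply: eps_open => x /= xd; exists (d - `|x - c|); first by rewrite subr_gt0.
move=> y yx; rewrite -(subrK x y) -addrA; apply: le_lt_trans (ler_normD _ _) _.
by rewrite -ltrBrDr.
Qed.

(** Norms take values in a field that is only partially ordered, so minima of
    radii are replaced by a common lower bound. *)
Lemma min_pos (a b : K) : 0 < a -> 0 < b ->
  exists2 d, 0 < d & forall x : K, x < d -> x < a /\ x < b.
Proof.
move=> a0 b0; have := @real_leVge K a b (gtr0_real a0) (gtr0_real b0).
move=> /orP[ab|ba]; [exists a|exists b] => // x xd; split => //.
  exact: lt_le_trans xd ab.
exact: lt_le_trans xd ba.
Qed.

End EpsilonDelta.

Lemma open_preimage (K : numFieldType) (V W : normedModType K) (U : set V) (U' : set W)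
    (f : V -> W) : open U -> open U' -> (forall x, U x -> {for x, continuous f}) ->
  open [set x | U x /\ U' (f x)].
Proof.
move=> oU oU' cf; rewrite openE => x [Ux Ufx] /=.
apply: filterI; first exact: open_nbhs_nbhs.
by apply: (cf x Ux); exact: open_nbhs_nbhs.
Qed.

Lemma open_neq0 (K : numFieldType) : open [set x : K | x != 0].
Proof.
apply: eps_open => c /= c0; exists `|c|; first by rewrite normr_gt0.
by move=> x; apply: contraTneq => ->; rewrite sub0r normrN ltxx.
Qed.

Section MeanValue.
Variables (K : numFieldType) (HK : geometrically_complete K).

Lemma geometric_small (x e : K) : 0 < e -> exists k, `|x| / 2 ^+ k < e.
Proof.
by move=> e0; have [k] := HK.1 x e e0; exists k; rewrite ltr_pdivrMr // exprn_gt0.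
Qed.

Lemma le_of_geometric (a b C : K) : a \is Num.real -> b \is Num.real ->
  (forall k, a <= b + C / 2 ^+ k) -> a <= b.
Proof.
move=> ra rb H; rewrite real_leNgt //; apply/negP => ba.
have [|k Hk] := @geometric_small C (a - b); first by rewrite subr_gt0.
have := H k; rewrite -lerBlDl.
have rC : C / 2 ^+ k \is Num.real.
  have : a - b <= C / 2 ^+ k by rewrite lerBlDl.
  by move/ger_real; rewrite rpredB.
move=> Hab; have := lt_le_trans Hk Hab.
have : C / 2 ^+ k <= `|C| / 2 ^+ k.
  rewrite -[X in _ <= _ / X]ger0_norm ?exprn_ge0 // -normfV -normrM.
  exact: real_ler_norm.
by move=> H1 H2; have := le_lt_trans H1 H2; rewrite ltxx.
Qed.

(** Bisection: a segment on which the growth rate exceeds the bound has a half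
    with the same defect, and the halves shrink to a point where the derivative
    exceeds the bound too.  This works over any complete archimedean field and
    needs no separate treatment of the complex case. *)
Lemma mean_value_ineq (f : K -> K) (z rho M a b : K) :
  (forall x, `|x - z| <= rho -> differentiable f x /\ `|derive1 f x| <= M) ->
  `|a - z| <= rho -> `|b - z| <= rho -> `|f b - f a| <= M * `|b - a|.
Proof.
move=> Hf az bz.
have M0 : 0 <= M by apply: le_trans (normr_ge0 _) (Hf a az).2.
have [->|ab] := eqVneq b a; first by rewrite !subrr normr0 mulr0.
rewrite real_leNgt ?normr_real ?rpredM ?normr_real ?ger0_real //.
apply/negP => HN.
have dpos : 0 < `|b - a| by rewrite normr_gt0 subr_eq0.
set del := b - a in dpos *.
pose N := `|f b - f a| / `|del|.
have NM : M < N by rewrite ltr_pdivlMr.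
have Ntr k : N * (`|del| / 2 ^+ k) \is Num.real.
  by apply: ger0_real; rewrite mulr_ge0 // divr_ge0 // exprn_ge0.
(* N is the growth rate of f on the whole segment; a piece is good if the rate
   on it is at least N. *)
pose good k p := N * (`|del| / 2 ^+ k) <= `|f (p + del / 2 ^+ k) - f p|.
pose step k p := if good k.+1 p then p else p + del / 2 ^+ k.+1.
pose u := fix u k := if k is k'.+1 then step k' (u k') else a.
have halves k : del / 2 ^+ k.+1 + del / 2 ^+ k.+1 = del / 2 ^+ k.
  by rewrite exprS; field; rewrite expf_neq0 ?pnatr_eq0.
have cvx p q : `|p - z| <= rho -> `|q - z| <= rho -> `|(p + q) / 2 - z| <= rho.
  move=> Hp Hq; have -> : (p + q) / 2 - z = ((p - z) + (q - z)) / 2.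
    by field.
  rewrite normrM normfV [`|2|]ger0_norm // ler_pdivrMr //.
  by apply: le_trans (ler_normD _ _) _; rewrite mulr_natr mulr2n lerD.
have inv k : [/\ good k (u k), `|u k - z| <= rho & `|u k + del / 2 ^+ k - z| <= rho].
  elim: k => [|k [gk uk vk]].
    have abE : a + del = b by rewrite /del addrC subrK.
    by rewrite /good /= expr0 !divr1 abE /N divfK ?gt_eqF.
  have mid : `|u k + del / 2 ^+ k.+1 - z| <= rho.
    suff -> : u k + del / 2 ^+ k.+1 = (u k + (u k + del / 2 ^+ k)) / 2 by exact: cvx.
    by rewrite exprS; field; rewrite expf_neq0 ?pnatr_eq0.
  rewrite [u k.+1]/(step k (u k)) /step; case: ifPn => [gd|ngd]; first by split.
  split => //; last by rewrite -(addrA (u k)) halves.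
  rewrite /good real_leNgt ?normr_real //.
  apply/negP => Hlt; move: ngd; rewrite /good -real_ltNge ?normr_real //.
  move=> Hlt2; move: gk; rewrite /good real_leNgt ?normr_real //.
  move=> /negP; apply.
  have -> : f (u k + del / 2 ^+ k) - f (u k) =
    (f (u k + del / 2 ^+ k.+1 + del / 2 ^+ k.+1) - f (u k + del / 2 ^+ k.+1)) +
    (f (u k + del / 2 ^+ k.+1) - f (u k)) by rewrite subrKA -(addrA (u k)) halves.
  apply: le_lt_trans (ler_normD _ _) _.
  have -> : N * (`|del| / 2 ^+ k) = N * (`|del| / 2 ^+ k.+1) + N * (`|del| / 2 ^+ k.+1).
    by rewrite exprS; field; rewrite expf_neq0 ?pnatr_eq0.
  exact: ltrD.
have nd k : `|del / 2 ^+ k| = `|del| / 2 ^+ k.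
  by rewrite normrM normfV [`|2 ^+ k|]ger0_norm // exprn_ge0.
have [c cP] : exists c, forall k, `|u k - c| <= 4 * `|del| / 2 ^+ k.
  apply: HK.2 => k; rewrite [u k.+1]/(step k (u k)) /step; case: ifP => _.
    by rewrite subrr normr0 divr_ge0 ?exprn_ge0.
  rewrite addrAC subrr add0r nd ler_wpM2l // lef_pV2 ?posrE ?exprn_gt0 //.
  by rewrite exprS ler_peMl ?exprn_ge0 // ler1n.
have rho0 : 0 <= rho by apply: le_trans az.
have cz : `|c - z| <= rho.
  apply: (@le_of_geometric _ _ (4 * `|del|)); rewrite ?normr_real ?ger0_real //.
  move=> k; have -> : c - z = (u k - z) - (u k - c) by ring.
  apply: le_trans (ler_normB _ _) _; apply: lerD (cP k); by have [] := inv k.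
have [dfc dfM] := Hf c cz.
(* The errors at the two ends of a piece add up to at most 9 e times its
   length, short of (N - M) times it. *)
pose e := (N - M) / 16.
have e0 : 0 < e by rewrite divr_gt0 // subr_gt0.
have [d d0 Hd] := differentiable_eps dfc e0.
have [k Hk] := geometric_small (5 * `|del|) d0.
set p := u k; set q := p + del / 2 ^+ k.
have [gk _ _] := inv k; rewrite -/p in gk.
pose t := `|del| / 2 ^+ k.
have t0 : 0 < t by rewrite divr_gt0 ?exprn_gt0.
have pc : `|p - c| <= 4 * t by rewrite mulrA; exact: cP.
have qc : `|q - c| <= 5 * t.
  rewrite /q addrAC; apply: le_trans (ler_normD _ _) _; rewrite nd -/t.
  by rewrite -[5]/((4 + 1)%:R) natrD mulrDl mul1r lerD2r.
have t5 : 5 * t < d by move: Hk; rewrite ger0_norm ?mulr_ge0 // -mulrA.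
have pd : `|p - c| < d.
  by apply: le_lt_trans pc (le_lt_trans _ t5); rewrite ler_wpM2r ?(ltW t0) // ler_nat.
have qd : `|q - c| < d by apply: le_lt_trans qc t5.
have key : `|f q - f p| <= M * t + e * (9 * t).
  have -> : f q - f p = derive1 f c * (q - p) + ((f q - f c - derive1 f c * (q - c))
      - (f p - f c - derive1 f c * (p - c))) by ring.
  apply: le_trans (ler_normD _ _) _; apply: lerD.
    rewrite normrM /q addrAC subrr add0r nd -/t ler_wpM2r // ltW //.
  apply: le_trans (ler_normB _ _) _.
  rewrite -[9]/((5 + 4)%:R) natrD mulrDl mulrDr; apply: lerD.
    by apply: le_trans (Hd _ qd) _; rewrite ler_wpM2l // ltW.
  by apply: le_trans (Hd _ pd) _; rewrite ler_wpM2l // ltW.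
have := le_trans gk key; rewrite -/t mulrA -mulrDl ler_pM2r // -lerBlDl.
have -> : N - M = e * 16 by rewrite /e divfK // pnatr_eq0.
by rewrite ler_pM2l // ler_nat.
Qed.

End MeanValue.

Section Schwarz.
Variables (K : numFieldType) (HK : geometrically_complete K).

(** Two applications of the mean value inequality, first in one variable and
    then in the other, to G minus the bilinear term s t A. *)
Lemma second_difference (G G1 G12 : K -> K -> K) (a b rho A e : K) :
  (forall s t, `|s - a| <= rho -> `|t - b| <= rho ->
    [/\ differentiable (G^~ t) s, derive1 (G^~ t) s = G1 s t,
        differentiable (G1 s) t, derive1 (G1 s) t = G12 s t &
        `|G12 s t - A| <= e]) ->
  0 <= rho ->
  `|G (a + rho) (b + rho) - G (a + rho) b - (G a (b + rho) - G a b) - rho * rho * A|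
    <= e * rho * rho.
Proof.
move=> H rho0.
have cen (c : K) : `|c - c| <= rho by rewrite subrr normr0.
have edge (c : K) : `|c + rho - c| <= rho by rewrite addrAC subrr add0r ger0_norm.
pose F s := G s (b + rho) - G s b + - (rho * A) * s.
have FB s : `|s - a| <= rho -> differentiable F s /\ `|derive1 F s| <= e * rho.
  move=> sa; have [d1 E1 _ _ _] := H _ _ sa (edge b).
  have [d0 E0 _ _ _] := H _ _ sa (cen b).
  have dl : differentiable (fun s : K => - (rho * A) * s) s.
    by apply: differentiableM.
  have dB : differentiable (fun s => G s (b + rho) - G s b) s.
    exact: differentiableB.
  split; first exact: differentiableD.
  rewrite d1_add // d1_mul // d1_cst d1_id mul0r add0r mulr1.
  rewrite d1_add //; last exact: differentiableN.
  have -> : derive1 (fun y => - G y b) s = - derive1 (G^~ b) s.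
    by rewrite !derive1E deriveN //; exact: diff_derivable.
  rewrite E1 E0.
  pose L t := G1 s t + - A * t.
  have LB t : `|t - b| <= rho -> differentiable L t /\ `|derive1 L t| <= e.
    move=> tb; have [_ _ dt Et Bt] := H _ _ sa tb.
    have dA : differentiable (fun t : K => - A * t) t by apply: differentiableM.
    split; first exact: differentiableD.
    by rewrite d1_add // d1_mul // d1_cst d1_id mul0r add0r mulr1 Et.
  have := mean_value_ineq HK LB (cen b) (edge b).
  rewrite [X in `|X - b|]addrC addrK (ger0_norm rho0).
  by congr (`|_| <= _); rewrite /L; ring.
have := mean_value_ineq HK FB (cen a) (edge a).
rewrite [X in `|X - a|]addrC addrK (ger0_norm rho0).
by congr (`|_| <= _); rewrite /F; ring.
Qed.

Lemma derive1_fst (g : K * K -> K) s t :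
  derive1 (fun s => g (s, t)) s = 'D_((1, 0) : K * K) g (s, t).
Proof.
rewrite /derive1 /derive; set d := (fun _ : K => _); set d' := (fun _ : K => _).
suff -> : d = d' by []; apply/funext => h; rewrite /d /d' /=.
congr (_ *: (g _ - _)); apply/esym.
rewrite -[LHS]/(h * 1 + s, h * 0 + t).
by rewrite mulr1 mulr0 add0r.
Qed.

Lemma derive1_snd (g : K * K -> K) s t :
  derive1 (fun t => g (s, t)) t = 'D_((0, 1) : K * K) g (s, t).
Proof.
rewrite /derive1 /derive; set d := (fun _ : K => _); set d' := (fun _ : K => _).
suff -> : d = d' by []; apply/funext => h; rewrite /d /d' /=.
congr (_ *: (g _ - _)); apply/esym.
rewrite -[LHS]/(h * 0 + s, h * 1 + t).
by rewrite mulr1 mulr0 add0r.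
Qed.

Lemma differentiable_fst (g : K * K -> K) s t :
  differentiable g (s, t) -> differentiable (fun s => g (s, t)) s.
Proof.
move=> dg; apply: (@differentiable_comp _ _ _ _ (fun s : K => (s, t)) g).
  exact: differentiable_pair.
exact: dg.
Qed.

Lemma differentiable_snd (g : K * K -> K) s t :
  differentiable g (s, t) -> differentiable (fun t => g (s, t)) t.
Proof.
move=> dg; apply: (@differentiable_comp _ _ _ _ (fun t : K => (s, t)) g).
  exact: differentiable_pair.
exact: dg.
Qed.

Lemma prod_norm_le (V W : normedModType K) (p : V * W) (r : K) :
  `|p.1| <= r -> `|p.2| <= r -> `|p| <= r.
Proof. by move=> H1 H2; rewrite prod_normE /Num.max; case: ifP. Qed.

(** Both mixed derivatives are the limit of one and the same second difference
    quotient. *)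
Lemma schwarz (U : set (K * K)) (g : K * K -> K) p : open U -> smooth_on U g -> U p ->
  'D_((0, 1) : K * K) ('D_((1, 0) : K * K) g) p =
  'D_((1, 0) : K * K) ('D_((0, 1) : K * K) g) p.
Proof.
move=> oU sg; case: p => a b Up.
set e1 := ((1, 0) : K * K); set e2 := ((0, 1) : K * K).
set A := 'D_e2 _ _; set B := 'D_e1 _ _.
have s1 := smooth_derive e1 sg; have s2 := smooth_derive e2 sg.
have s12 := smooth_derive e2 s1; have s21 := smooth_derive e1 s2.
suff H e : 0 < e -> `|A - B| <= e + e.
  apply/eqP; rewrite -subr_eq0 -normr_eq0; apply/negPn/negP => AB.
  have AB0 : 0 < `|A - B| / 4 by rewrite divr_gt0 // lt_def AB normr_ge0.
  have := H _ AB0; have -> : `|A - B| / 4 + `|A - B| / 4 = `|A - B| / 2 by field.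
  have AB1 : 0 < `|A - B| by rewrite lt_def AB normr_ge0.
  by rewrite lt_geF // ltr_pdivrMr // ltr_pMr // ltr1n.
move=> e0.
have [d1 d10 Hd1] := continuous_eps (smooth_cont s12 Up) e0.
have [d2 d20 Hd2] := continuous_eps (smooth_cont s21 Up) e0.
have [d3 d30 Hd3] := open_eps oU Up.
have [d4 d40 Hd4] := min_pos d10 d20.
have [d d0 Hd] := min_pos d30 d40.
pose rho := d / 2.
have rho0 : 0 < rho by rewrite divr_gt0.
have rhod : rho < d by rewrite ltr_pdivrMr // ltr_pMr // ltr1n.
have near_p s t : `|s - a| <= rho -> `|t - b| <= rho ->
    [/\ U (s, t), `|'D_e2 ('D_e1 g) (s, t) - A| <= e &
      `|'D_e1 ('D_e2 g) (s, t) - B| <= e].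
  move=> sa tb.
  have st : `|(s, t) - (a, b)| < d.
    by apply: le_lt_trans rhod; apply: prod_norm_le.
  have [st3 /Hd4[st1 st2]] := Hd _ st.
  by split; [exact: Hd3|apply/ltW/Hd1|apply/ltW/Hd2].
have HA := @second_difference (fun s t => g (s, t)) (fun s t => 'D_e1 g (s, t))
  (fun s t => 'D_e2 ('D_e1 g) (s, t)) a b rho A e.
have HB := @second_difference (fun t s => g (s, t)) (fun t s => 'D_e2 g (s, t))
  (fun t s => 'D_e1 ('D_e2 g) (s, t)) b a rho B e.
have {}HA : `|g (a + rho, b + rho) - g (a + rho, b) - (g (a, b + rho) - g (a, b))
    - rho * rho * A| <= e * rho * rho.
  apply: (HA _ (ltW rho0)) => s t sa tb.
  have [Ust bA _] := near_p _ _ sa tb; split; last exact: bA.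
  - exact: (@differentiable_fst g _ _ (smooth_diff sg Ust)).
  - exact: (@derive1_fst g).
  - exact: (@differentiable_snd ('D_e1 g) _ _ (smooth_diff s1 Ust)).
  - exact: (@derive1_snd ('D_e1 g)).
have {}HB : `|g (a + rho, b + rho) - g (a, b + rho) - (g (a + rho, b) - g (a, b))
    - rho * rho * B| <= e * rho * rho.
  apply: (HB _ (ltW rho0)) => t s tb sa.
  have [Ust _ bB] := near_p _ _ sa tb; split; last exact: bB.
  - exact: (@differentiable_snd g _ _ (smooth_diff sg Ust)).
  - exact: (@derive1_snd g).
  - exact: (@differentiable_fst ('D_e2 g) _ _ (smooth_diff s2 Ust)).
  - exact: (@derive1_fst ('D_e2 g)).
have rr0 : 0 < rho * rho by rewrite mulr_gt0.
rewrite -(ler_pM2r rr0) -{1}(ger0_norm (ltW rr0)) -normrM.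
have -> : (A - B) * (rho * rho) =
  (g (a + rho, b + rho) - g (a, b + rho) - (g (a + rho, b) - g (a, b)) - rho * rho * B)
  - (g (a + rho, b + rho) - g (a + rho, b) - (g (a, b + rho) - g (a, b))
    - rho * rho * A) by ring.
apply: le_trans (ler_normB _ _) _.
by rewrite [leRHS]mulrDl [e * (_ * _)]mulrA; exact: (lerD HB HA).
Qed.

End Schwarz.

Section Primitive.
Variables (K : numFieldType) (HK : geometrically_complete K).

(** On each of the N steps the error is of second order, C / N ^ 2. *)
Lemma riemann_sum (g g1 g2 : K -> K) (C : K) N : (0 < N)%N ->
  (forall t, `|t| <= 1 -> [/\ differentiable g t, derive1 g t = g1 t,
     differentiable g1 t, derive1 g1 t = g2 t & `|g2 t| <= C]) ->
  `|N%:R^-1 * (\sum_(i < N) g1 (i%:R / N%:R)) - (g 1 - g 0)| <= C / N%:R.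
Proof.
move=> N0 H; have Nr0 : 0 < N%:R :> K by rewrite ltr0n.
have Nn0 := lt0r_neq0 Nr0.
have C0 : 0 <= C.
  have [|_ _ _ _] := H 0; first by rewrite normr0.
  exact: le_trans.
have -> : g 1 - g 0 = \sum_(i < N) (g (i.+1%:R / N%:R) - g (i%:R / N%:R)).
  rewrite -(big_mkord xpredT (fun i => g (i.+1%:R / N%:R) - g (i%:R / N%:R))).
  by rewrite (telescope_sumr (fun i => g (i%:R / N%:R))) // mul0r divff.
rewrite mulr_sumr -sumrB.
apply: le_trans (ler_norm_sum _ _ _) _.
have -> : C / N%:R = \sum_(i < N) (C * N%:R^-1 * N%:R^-1).
  by rewrite sumr_const card_ord -[RHS]mulr_natr divfK.
apply: ler_sum => i _; pose t := i%:R / N%:R : K.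
have tN : i.+1%:R / N%:R = t + N%:R^-1 by rewrite /t -natr1 mulrDl mul1r.
have t0 : 0 <= t by rewrite divr_ge0.
have t1 : t + N%:R^-1 <= 1.
  by rewrite -tN ler_pdivrMr // mul1r ler_nat.
have Vn : `|N%:R^-1 : K| = N%:R^-1 by rewrite ger0_norm ?invr_ge0.
have in1 tau : `|tau - t| <= N%:R^-1 -> `|tau| <= 1.
  move=> Ht; rewrite -(subrK t tau); apply: le_trans (ler_normD _ _) _.
  by rewrite (ger0_norm t0) addrC; apply: le_trans t1; rewrite lerD2l.
have g1L tau : `|tau - t| <= N%:R^-1 -> `|g1 tau - g1 t| <= C * N%:R^-1.
  move=> Ht; have Hb x : `|x - 0| <= 1 -> differentiable g1 x /\ `|derive1 g1 x| <= C.
    by rewrite subr0 => /H[_ _ d1 -> b2].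
  apply: le_trans (mean_value_ineq HK Hb _ _) _; rewrite ?subr0.
  - by apply: in1; rewrite subrr normr0 invr_ge0 ltW.
  - exact: in1.
  - by rewrite ler_wpM2l.
pose q tau := g tau + - g1 t * tau.
have Hq x : `|x - t| <= N%:R^-1 -> differentiable q x /\ `|derive1 q x| <= C * N%:R^-1.
  move=> xt; have [dg Eg _ _ _] := H x (in1 _ xt).
  have dl : differentiable (fun y : K => - g1 t * y) x by apply: differentiableM.
  split; first exact: differentiableD.
  by rewrite d1_add // d1_mul // d1_cst d1_id mul0r add0r mulr1 Eg; exact: g1L.
have tt : `|t - t| <= N%:R^-1 by rewrite subrr normr0 invr_ge0 ltW.
have tn : `|t + N%:R^-1 - t| <= N%:R^-1 by rewrite [X in `|X - t|]addrC addrK Vn.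
have := mean_value_ineq HK Hq tt tn.
rewrite [X in `|X - t|]addrC addrK Vn tN -/t distrC.
by congr (`|_| <= _); rewrite /q; ring.
Qed.

Lemma bounded_near (f : K -> K) c : {for c, continuous f} ->
  exists2 d : K, 0 < d & forall x, `|x - c| < d -> `|f x| <= `|f c| + 1.
Proof.
move=> cf; have [d d0 Hd] := continuous_eps cf (@ltr01 K); exists d => // x /Hd Hx.
rewrite -(subrK (f c) (f x)) addrC; apply: le_trans (ler_normD _ _) _.
by rewrite lerD2l ltW.
Qed.

(** The Riemann sums along the rays from the base point converge, together with
    their derivatives: the derivative of such a sum is again a Riemann sum, for
    the integral over [0, 1] of the derivative of t * f (z0 + t (z - z0)). *)
Lemma local_primitive (U : set K) (f : K -> K) z0 : open U -> smooth_on U f -> U z0 ->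
  exists (rho : K) (F : K -> K), [/\ 0 < rho, forall z, `|z - z0| < rho -> U z,
    smooth_on [set z | `|z - z0| < rho] F,
    forall z, `|z - z0| < rho -> derive1 F z = f z & F z0 = 0].
Proof.
move=> oU sf Uz0.
have sf1 := smooth_d1 oU sf; have sf2 := smooth_d1 oU sf1.
have [d1 d10 Hd1] := bounded_near (smooth_cont sf1 Uz0).
have [d2 d20 Hd2] := bounded_near (smooth_cont sf2 Uz0).
have [d3 d30 Hd3] := open_eps oU Uz0.
have [d4 d40 Hd4] := min_pos d10 d20.
have [d d0 Hd] := min_pos d30 d40.
set M1 := `|derive1 f z0| + 1 in Hd1; set M2 := `|derive1 (derive1 f) z0| + 1 in Hd2.
pose rho := d / 2.
have rho0 : 0 < rho by rewrite divr_gt0.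
have rhod : rho < d by rewrite ltr_pdivrMr // ltr_pMr // ltr1n.
have inB z : `|z - z0| <= rho ->
    [/\ U z, `|derive1 f z| <= M1 & `|derive1 (derive1 f) z| <= M2].
  move=> zr; have [/Hd3 Uz /Hd4[/Hd1 b1 /Hd2 b2]] := Hd _ (le_lt_trans zr rhod).
  by split.
(* A bound for the second derivative of t * f (z0 + t (z - z0)) on |t| <= 1. *)
pose C := 2 * rho * M1 + rho * rho * M2.
have M10 : 0 <= M1 by rewrite addr_ge0.
have M20 : 0 <= M2 by rewrite addr_ge0.
have rho_ge0 := ltW rho0.
have C0 : 0 <= C.
  by apply: addr_ge0; apply: mulr_ge0 => //; apply: mulr_ge0.
pose pt (s z : K) := z0 + s * (z - z0).
have ptB s z : `|z - z0| <= rho -> `|s| <= 1 -> `|pt s z - z0| <= rho.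
  move=> zr s1; rewrite /pt addrC addKr normrM; apply: le_trans zr.
  by rewrite ler_piMl.
have dpt (s z : K) : differentiable (pt s) z /\ derive1 (pt s) z = s.
  have dl : differentiable (fun z : K => z - z0) z by exact: differentiableB.
  have dm : differentiable (fun z : K => s * (z - z0)) z by apply: differentiableM.
  split; first exact: differentiableD.
  by rewrite /pt d1_add // d1_cst add0r d1_mul // d1_cst mul0r add0r
       d1_add // d1_id d1_cst addr0 mulr1.
have dpt' (s z : K) : differentiable (pt^~ z) s /\ derive1 (pt^~ z) s = z - z0.
  have dm : differentiable (fun s : K => s * (z - z0)) s by apply: differentiableM.
  split; first exact: differentiableD.
  by rewrite /pt d1_add // d1_cst add0r d1_mul // d1_cst mulr0 addr0 d1_id mul1r.
pose P k z := (2 ^ k)%:R^-1 * \sum_(i < 2 ^ k) ((z - z0) * f (pt (i%:R / (2 ^ k)%:R) z)).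
pose P1 k z := (2 ^ k)%:R^-1 * \sum_(i < 2 ^ k) (f (pt (i%:R / (2 ^ k)%:R) z)
   + (i%:R / (2 ^ k)%:R) * (z - z0) * derive1 f (pt (i%:R / (2 ^ k)%:R) z)).
have frac k (i : 'I_(2 ^ k)) : `|i%:R / (2 ^ k)%:R : K| <= 1.
  rewrite ger0_norm ?divr_ge0 // ler_pdivrMr ?ltr0n ?expn_gt0 // mul1r ler_nat.
  by apply: ltnW.
have dP k z : `|z - z0| <= rho -> differentiable (P k) z /\ derive1 (P k) z = P1 k z.
  move=> zr.
  have di (i : 'I_(2 ^ k)) : 
    differentiable (fun z : K => (z - z0) * f (pt (i%:R / (2 ^ k)%:R) z)) z /\
    derive1 (fun z : K => (z - z0) * f (pt (i%:R / (2 ^ k)%:R) z)) z =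
      f (pt (i%:R / (2 ^ k)%:R) z)
   + (i%:R / (2 ^ k)%:R) * (z - z0) * derive1 f (pt (i%:R / (2 ^ k)%:R) z).
    set s : K := i%:R / _.
    have [Up _ _] := inB _ (ptB s z zr (frac k i)).
    have dl : differentiable (fun z : K => z - z0) z by exact: differentiableB.
    have df := smooth_diff sf Up; have [dp Ep] := dpt s z.
    have dc : differentiable (fun z : K => f (pt s z)) z.
      exact: (@differentiable_comp _ _ _ _ (pt s) f).
    split; first exact: differentiableM.
    by rewrite d1_mul // d1_add // d1_id d1_cst addr0 mul1r d1_chain // Ep; ring.
  have ds := diff_sum (index_enum 'I_(2 ^ k)) (fun i => (di i).1).
  split; first exact: differentiableM.
  rewrite d1_mul // d1_cst mul0r add0r derive1E Dv_sum; last by move=> i; exact: (di i).1.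
  by congr (_ * _); apply: eq_bigr => i _; rewrite -derive1E (di i).2.
have P1f k z : `|z - z0| <= rho -> `|P1 k z - f z| <= C / 2 ^+ k.
  move=> zr; pose dz := z - z0.
  pose g t := t * f (pt t z).
  pose g1 t := f (pt t z) + t * dz * derive1 f (pt t z).
  pose g2 t := dz * derive1 f (pt t z) + (dz * derive1 f (pt t z)
    + t * dz * (dz * derive1 (derive1 f) (pt t z))).
  have := @riemann_sum g g1 g2 C (2 ^ k).
  rewrite /g mul1r mul0r subr0 natrX.
  have -> : pt 1 z = z by rewrite /pt mul1r addrC subrK.
  rewrite -natrX expn_gt0 /= => /(_ isT); apply => t t1.
  have [Up b1 b2] := inB _ (ptB t z zr t1).
  have [dp Ep] := dpt' t z.
  have dc : differentiable (fun t : K => f (pt t z)) t.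
    exact: (@differentiable_comp _ _ _ _ (pt^~ z) f _ dp (smooth_diff sf Up)).
  have dc1 : differentiable (fun t : K => derive1 f (pt t z)) t.
    exact: (@differentiable_comp _ _ _ _ (pt^~ z) (derive1 f) _ dp (smooth_diff sf1 Up)).
  have dl : differentiable (fun t : K => t * dz) t by apply: differentiableM.
  have dm : differentiable (fun t : K => t * dz * derive1 f (pt t z)) t.
    exact: differentiableM.
  have Ec : derive1 (fun t : K => f (pt t z)) t = dz * derive1 f (pt t z).
    by rewrite d1_chain ?Ep 1?mulrC //; exact: smooth_diff Up.
  have Ec1 : derive1 (fun t : K => derive1 f (pt t z)) t = dz * derive1 (derive1 f) (pt t z).
    by rewrite (@d1_chain _ (pt^~ z) (derive1 f)) ?Ep 1?mulrC //; exact: smooth_diff Up.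
  split.
  - exact: differentiableM.
  - by rewrite d1_mul // d1_id mul1r Ec /g1 mulrA.
  - exact: differentiableD.
  - rewrite /g1 d1_add // Ec d1_mul // Ec1 d1_mul // d1_id d1_cst /g2 mul1r mulr0.
    by rewrite addr0.
  have B1 : `|dz * derive1 f (pt t z)| <= rho * M1.
    by rewrite normrM ler_pM.
  rewrite /g2 addrA; apply: le_trans (ler_normD _ _) _; rewrite /C; apply: lerD.
    apply: le_trans (ler_normD _ _) _.
    by rewrite -mulrA mulr_natl mulr2n lerD.
  rewrite -mulrA normrM; apply: le_trans (ler_piMl (normr_ge0 _) t1) _.
  rewrite normrM -(mulrA rho rho); apply: ler_pM => //.
  by rewrite normrM; apply: ler_pM.
have Pz0 k : P k z0 = 0.
  by rewrite /P big1 ?mulr0 // => i _; rewrite subrr mul0r.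
have z0B : `|z0 - z0| <= rho by rewrite subrr normr0 ltW.
have stepP k z : `|z - z0| <= rho -> `|P k.+1 z - P k z| <= (2 * C * rho) / 2 ^+ k.
  move=> zr; pose D z := P k.+1 z - P k z.
  have HD x : `|x - z0| <= rho -> differentiable D x /\ `|derive1 D x| <= 2 * C / 2 ^+ k.
    move=> xr; have [dk Ek] := dP k x xr; have [dk1 Ek1] := dP k.+1 x xr.
    split; first exact: differentiableB.
    have -> : derive1 D x = (P1 k.+1 x - f x) - (P1 k x - f x).
      rewrite /D derive1E (@deriveB _ _ _ (P k.+1) (P k)); try exact: diff_derivable.
      by rewrite -!derive1E Ek Ek1; ring.
    apply: le_trans (ler_normB _ _) _.
    rewrite -mulrA mulr_natl mulr2n; apply: lerD; last exact: P1f.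
    apply: le_trans (P1f _ _ xr) _; rewrite ler_wpM2l // lef_pV2 ?posrE ?exprn_gt0 //.
    by rewrite exprS ler_peMl ?exprn_ge0 // ler1n.
  have := mean_value_ineq HK HD z0B zr; rewrite /D !Pz0 subrr subr0 => H.
  apply: le_trans H _; rewrite mulrAC ler_wpM2r ?invr_ge0 ?exprn_ge0 //.
  by rewrite ler_wpM2l // mulr_ge0.
have /choice [F FP] : forall z, exists l, `|z - z0| <= rho ->
    forall k, `|P k z - l| <= 4 * (2 * C * rho) / 2 ^+ k.
  move=> z; have [zr|nzr] := boolP (`|z - z0| <= rho); last by exists 0.
  by have [l lP] := HK.2 (P ^~ z) _ (fun k => stepP k z zr); exists l.
have F1 c : `|c - z0| < rho -> differentiable F c /\ derive1 F c = f c.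
  move=> cr; have [Uc _ _] := inB _ (ltW cr).
  apply: eps_differentiable => e e0.
  have [a a0 Ha] := continuous_eps (smooth_cont sf Uc) e0.
  have [|b b0 Hb] := @min_pos K a (rho - `|c - z0|) a0; first by rewrite subr_gt0.
  exists b => // x xc; have [_ xr'] := Hb _ xc.
  have ballr y : `|y - c| <= `|x - c| -> `|y - z0| <= rho.
    move=> yc; rewrite -(subrK c y) -addrA; apply: le_trans (ler_normD _ _) _.
    by rewrite -lerBrDr; apply: le_trans yc (ltW xr').
  have cr' := ltW cr; have xr := ballr x (lexx _).
  apply: (@le_of_geometric K HK _ _ (C * `|x - c| + 8 * (2 * C * rho))).
  - exact: normr_real.
  - by apply: ger0_real; rewrite mulr_ge0 // ltW.
  move=> k; pose q y := P k y + - f c * y.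
  have Hq y : `|y - c| <= `|x - c| ->
      differentiable q y /\ `|derive1 q y| <= C / 2 ^+ k + e.
    move=> yc; have yr := ballr y yc; have [dk Ek] := dP k y yr.
    have dl : differentiable (fun y : K => - f c * y) y by apply: differentiableM.
    split; first exact: differentiableD.
    have El : derive1 (fun y : K => - f c * y) y = - f c.
      by rewrite d1_mul // d1_cst d1_id mul0r add0r mulr1.
    rewrite d1_add // Ek El.
    rewrite -(subrKA (f y)); apply: le_trans (ler_normD _ _) _.
    by apply: lerD; [exact: P1f|apply/ltW/Ha; have [] := Hb _ (le_lt_trans yc xc)].
  have := mean_value_ineq HK Hq; move=> /(_ c x); rewrite subrr normr0 normr_ge0.
  move=> /(_ isT (lexx _)) Hm.
  have -> : F x - F c - f c * (x - c) =
     (q x - q c) - (P k x - F x) + (P k c - F c) by rewrite /q; ring.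
  apply: le_trans (ler_normD _ _) _.
  apply: le_trans (lerD (le_trans (ler_normB _ _) (lerD Hm (FP x xr k))) (FP c cr' k)) _.
  rewrite le_eqVlt; apply/orP; left; apply/eqP; field.
  by rewrite expf_neq0 // pnatr_eq0.
exists rho, F; split => //.
- by move=> z /ltW /inB[].
- apply: smooth_of_d1; first exact: open_norm_ball.
    by move=> x /F1[].
  apply: (@smooth_ext _ _ _ _ _ f); first exact: open_norm_ball.
    by move=> x /F1[].
  by apply: smooth_sub sf => x /ltW /inB[].
- by move=> z /F1[].
have z0F := FP z0 z0B.
apply/eqP; rewrite -normr_le0.
apply: (@le_of_geometric K HK _ _ (4 * (2 * C * rho))) => //.
  exact: normr_real.
by move=> k; have := z0F k; rewrite Pz0 sub0r normrN add0r.
Qed.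

End Primitive.

Section LocalInverse.
Variables (K : numFieldType) (HK : geometrically_complete K).

(** Near z0 the map q x = x - f x / f' z0 contracts by 1/2.  This makes f
    injective with a Lipschitz inverse, and iterating x |-> q x + y / f' z0 from
    a point whose image is close to y converges to a preimage of y. *)
Lemma local_inverse (U : set K) (f : K -> K) z0 : open U -> smooth_on U f -> U z0 ->
  derive1 f z0 != 0 ->
  exists (A V : set K) (psi : K -> K),
    [/\ [/\ open A, A z0 & A `<=` U], [/\ open V, V (f z0) & smooth_on V psi],
      [/\ forall z, A z -> V (f z), forall x, V x -> A (psi x),
        forall z, A z -> psi (f z) = z & forall x, V x -> f (psi x) = x],
      forall z, A z -> derive1 f z != 0 &
      forall x, V x -> derive1 psi x = (derive1 f (psi x))^-1].
Proof.
move=> oU sf Uz0; set c := derive1 f z0 => c0.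
have sf1 := smooth_d1 oU sf.
have nc0 : 0 < `|c| by rewrite normr_gt0.
have hc0 : 0 < `|c| / 2 by rewrite divr_gt0.
have [d1 d10 Hd1] := continuous_eps (smooth_cont sf1 Uz0) hc0.
have [d2 d20 Hd2] := open_eps oU Uz0.
have [d d0 Hd] := min_pos d10 d20.
pose rho := d / 2.
have rho0 : 0 < rho by rewrite divr_gt0.
have rhod : rho < d by rewrite ltr_pdivrMr // ltr_pMr // ltr1n.
have inB z : `|z - z0| <= rho -> U z /\ `|derive1 f z - c| < `|c| / 2.
  by move=> zr; have [/Hd1 b1 /Hd2 Uz] := Hd _ (le_lt_trans zr rhod).
have f1n0 z : `|z - z0| <= rho -> derive1 f z != 0.
  move=> /inB[_]; apply: contraTneq => ->; rewrite sub0r normrN.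
  by rewrite -real_leNgt ?normr_real ?gtr0_real // ler_pdivrMr // ler_peMr // ler1n.
pose q x := x + - c^-1 * f x.
have Hq x : `|x - z0| <= rho -> differentiable q x /\ `|derive1 q x| <= 2^-1.
  move=> xr; have [Ux b1] := inB x xr; have df := smooth_diff sf Ux.
  have dl : differentiable (fun x : K => - c^-1 * f x) x by apply: differentiableM.
  split; first exact: differentiableD.
  rewrite d1_add // d1_id d1_mul // d1_cst mul0r add0r.
  have -> : 1 + - c^-1 * derive1 f x = - (derive1 f x - c) / c by field.
  by rewrite normrM normrN normfV ler_pdivrMr // mulrC ltW.
have qL x y : `|x - z0| <= rho -> `|y - z0| <= rho -> `|q x - q y| <= 2^-1 * `|x - y|.
  by move=> xr yr; exact: (mean_value_ineq HK Hq yr xr).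
have fq x y : f x - f y = c * ((x - y) - (q x - q y)) by rewrite /q; field.
have low x y : `|x - z0| <= rho -> `|y - z0| <= rho -> `|x - y| <= 2 / `|c| * `|f x - f y|.
  move=> xr yr; rewrite fq normrM mulrA divfK ?gt_eqF //.
  have := lerB_dist (x - y) (q x - q y); have := qL x y xr yr => H1 H2.
  have := le_trans (lerB (lexx `|x - y|) H1) H2.
  have -> : `|x - y| - 2^-1 * `|x - y| = 2^-1 * `|x - y| by field.
  by rewrite ler_pdivrMl.
have up x y : `|x - z0| <= rho -> `|y - z0| <= rho -> `|f x - f y| <= `|c| * 2 * `|x - y|.
  move=> xr yr; rewrite fq normrM -mulrA ler_wpM2l //.
  apply: le_trans (ler_normB _ _) _; rewrite mulr_natl mulr2n lerD2l.
  apply: le_trans (qL x y xr yr) _; rewrite ler_piMl // invf_le1 ?ler1n //.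
pose A := [set z | `|z - z0| < rho]; pose V := [set f z | z in A].
have Vopen x1 : V x1 -> exists2 e : K, 0 < e & forall y, `|y - x1| < e -> V y.
  move=> [z1 /= z1r <-]; pose sg := (rho - `|z1 - z0|) / 2.
  have sg0 : 0 < sg by rewrite divr_gt0 // subr_gt0.
  (* The iteration started at z1 stays within 4 |y - f z1| / |c| of z1. *)
  exists (`|c| * sg / 4); first by rewrite divr_gt0 // mulr_gt0.
  have ballA y : `|y - z1| <= sg -> `|y - z0| < rho.
    move=> yz; rewrite -(subrK z1 y) -addrA; apply: le_lt_trans (ler_normD _ _) _.
    apply: le_lt_trans (lerD yz (lexx _)) _.
    by rewrite -ltrBrDr /sg ltr_pdivrMr // ltr_pMr ?ltr1n // subr_gt0.
  move=> y yx; pose eta := `|y - f z1| / `|c|.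
  have eta0 : 0 <= eta by rewrite divr_ge0.
  have eta4 : 4 * eta <= sg.
    rewrite /eta mulrA ler_pdivrMr // mulrC -ler_pdivlMr //.
    by rewrite [sg * _]mulrC ltW.
  pose u := fix u k := if k is k'.+1 then u k' + (y - f (u k')) / c else z1.
  have uS k : u k.+1 = q (u k) + y / c by rewrite /= /q; field.
  have u4 j : `|u j - z1| + 2 * eta / 2 ^+ j <= 2 * eta -> `|u j - z0| <= rho.
    move=> Hj; apply/ltW/ballA; apply: le_trans eta4.
    have p1 : 0 <= 2 * eta / 2 ^+ j.
      by apply: divr_ge0; [exact: mulr_ge0|exact: exprn_ge0].
    apply: (@le_trans _ _ (2 * eta)); last by rewrite ler_wpM2r // ler_nat.
    by apply: le_trans Hj; rewrite lerDl.
  have inv k : `|u k - z1| + 2 * eta / 2 ^+ k <= 2 * eta /\ `|u k.+1 - u k| <= eta / 2 ^+ k.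
    elim: k => [|k [uk vk]].
      rewrite subrr normr0 add0r expr0 divr1; split => //.
      by rewrite /= addrC addKr normrM normfV divr1.
    have uk1 : `|u k.+1 - z1| + 2 * eta / 2 ^+ k.+1 <= 2 * eta.
      apply: le_trans uk.
      have -> : u k.+1 - z1 = (u k.+1 - u k) + (u k - z1) by rewrite subrKA.
      apply: le_trans (lerD (ler_normD _ _) (lexx _)) _.
      have -> : 2 * eta / 2 ^+ k = eta / 2 ^+ k + 2 * eta / 2 ^+ k.+1.
        by rewrite exprS; field; rewrite expf_neq0 // pnatr_eq0.
      by rewrite [leRHS]addrA lerD2r [leRHS]addrC lerD2r.
    split => //.
    have -> : u k.+2 - u k.+1 = q (u k.+1) - q (u k).
      by rewrite (uS k.+1) {2}(uS k); ring.
    apply: le_trans (qL _ _ (u4 _ uk1) (u4 _ uk)) _.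
    by rewrite exprS invfM mulrCA ler_wpM2l // invr_ge0.
  have [l lP] := HK.2 u eta (fun k => (inv k).2).
  have lz1 : `|l - z1| <= sg.
    by apply: le_trans eta4; have := lP 0%N; rewrite expr0 divr1 distrC.
  have lr := ballA _ lz1; exists l => //.
  have ur k : `|u k - z0| <= rho := u4 k (inv k).1.
  apply/eqP; rewrite -subr_eq0 -normr_le0.
  apply: (@le_of_geometric K HK _ _ (9 * `|c| * eta)) => //; first exact: normr_real.
  move=> k; have -> : f l - y = - (f (u k) - f l) - c * (u k.+1 - u k) by rewrite /=; field.
  apply: le_trans (ler_normB _ _) _; rewrite normrN normrM add0r.
  have H1 := le_trans (up _ _ (ur k) (ltW lr)) (ler_wpM2l _ (lP k)).
  have H2 := ler_wpM2l (ltW nc0) (inv k).2.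
  apply: le_trans (lerD (H1 _) H2) _; first by rewrite mulr_ge0.
  rewrite le_eqVlt; apply/orP; left; apply/eqP; field.
  by rewrite expf_neq0 // pnatr_eq0.
have oV : open V by apply: eps_open.
have /choice [psi Hpsi] : forall y, exists z, V y -> A z /\ f z = y.
  move=> y; have [[z Az <-]|nV] := pselect (V y); first by exists z.
  by exists 0 => /nV.
have psiA y : V y -> A (psi y) by move=> /Hpsi[].
have fpsi y : V y -> f (psi y) = y by move=> /Hpsi[].
have psif z : A z -> psi (f z) = z.
  move=> Az; have Vf : V (f z) by exists z.
  apply/eqP; rewrite -subr_eq0 -normr_le0.
  apply: le_trans (low _ _ (ltW (psiA _ Vf)) (ltW Az)) _.
  by rewrite fpsi // subrr normr0 mulr0.
have psi1 y0 : V y0 -> differentiable psi y0 /\ derive1 psi y0 = (derive1 f (psi y0))^-1.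
  move=> Vy0; have Az1 := psiA _ Vy0; set z1 := psi y0 in Az1 *.
  have [Uz1 _] := inB _ (ltW Az1); have fz0 := f1n0 _ (ltW Az1).
  set a := derive1 f z1 in fz0 *; have a0 : 0 < `|a| by rewrite normr_gt0.
  apply: eps_differentiable => e e0.
  have e1 : 0 < e * (`|a| * `|c| / 2) by rewrite mulr_gt0 // divr_gt0 // mulr_gt0.
  have [b b0 Hb] := differentiable_eps (smooth_diff sf Uz1) e1.
  have [g g0 Hg] := Vopen _ Vy0.
  have [|h h0 Hh] := @min_pos K g (b * `|c| / 2) g0.
    by rewrite divr_gt0 // mulr_gt0.
  exists h => // y yh; have [/Hg Vy yb] := Hh _ yh.
  have Lz : `|psi y - z1| <= 2 / `|c| * `|y - y0|.
    have := low _ _ (ltW (psiA _ Vy)) (ltW Az1).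
    by rewrite fpsi // [f z1]fpsi.
  have zb : `|psi y - z1| < b.
    apply: le_lt_trans Lz _; rewrite mulrAC ltr_pdivrMr // mulrC -ltr_pdivlMr //.
  have := Hb _ zb; rewrite -/a fpsi // [f z1]fpsi // => Hr.
  have -> : psi y - z1 - a^-1 * (y - y0) = - a^-1 * (y - y0 - a * (psi y - z1)) by field.
  rewrite normrM normrN normfV mulrC ler_pdivrMr //.
  apply: le_trans Hr _; apply: le_trans (ler_wpM2l (ltW e1) Lz) _.
  rewrite le_eqVlt; apply/orP; left; apply/eqP; field.
  by rewrite gt_eqF.
exists A, V, psi; split => //.
- split; [exact: open_norm_ball|by rewrite /A /= subrr normr0|].
  by move=> z /ltW/inB[].
- split => //; first by exists z0 => //; rewrite /A /= subrr normr0.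
  elim=> [|k IH]; first by move=> y /psi1[/differentiable_continuous].
  split=> [y /psi1[]//|v].
  have AU : forall y, V y -> U (psi y) by move=> y /psiA /ltW/inB[].
  have Cc := @class_C_comp K _ _ _ frameK k V U psi (derive1 f) frameK oV oU AU IH (sf1 k).
  have Ci := class_CV oV (fun y Vy => f1n0 _ (ltW (psiA y Vy))) Cc.
  apply: class_C_ext (class_CM oV (class_C_cst k V v) Ci) => // y Vy.
  by have [dy Ey] := psi1 y Vy; rewrite deriveE // diff1E // Ey.
- by split => // z Az; exists z.
- by move=> z /ltW /f1n0.
- by move=> y /psi1[].
Qed.

End LocalInverse.

Section LinearODE.
Variables (K : numFieldType) (HK : geometrically_complete K).

(** The exponential is obtained as the local inverse of a primitive of 1/z. *)
Lemma local_exponential : exists (V : set K) (E : K -> K),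
  [/\ open V, V 0, smooth_on V E, forall x, V x -> E x != 0 &
      forall x, V x -> derive1 E x = E x].
Proof.
pose U := [set z : K | z != 0].
have oU : open U := @open_neq0 K.
have sI : smooth_on U (fun z : K => z^-1).
  by apply: smoothV => //; exact: smooth_id.
have [rho [L [rho0 ballU sL L1 L0]]] := local_primitive HK oU sI (oner_neq0 K : U 1).
have B1 : `|1 - 1 : K| < rho by rewrite subrr normr0.
have oB := open_norm_ball (1 : K) rho.
have [|A [V [E [[oA A1 AB] [oV V0 sE] [_ EA _ _] _ E1]]]] := local_inverse HK oB sL B1.
  by rewrite L1 // invr_neq0 // oner_neq0.
exists V, E; split => //; first by rewrite -L0.
  by move=> x /EA /AB /ballU.
by move=> x Vx; rewrite E1 // L1 ?invrK //; apply: AB; exact: EA.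
Qed.

Lemma local_linear_ode (U : set K) (q : K -> K) x0 : open U -> smooth_on U q -> U x0 ->
  exists (W : set K) (h : K -> K), [/\ [/\ open W, W x0 & W `<=` U], smooth_on W h,
    forall x, W x -> h x != 0 & forall x, W x -> derive1 h x = q x * h x].
Proof.
move=> oU sq Ux0.
have [V [E [oV V0 sE En0 E1]]] := local_exponential.
have [rho [G [rho0 ballU sG G1 G0]]] := local_primitive HK oU sq Ux0.
have oB := open_norm_ball x0 rho.
pose W := [set x | `|x - x0| < rho /\ V (G x)].
have oW : open W by apply: open_preimage => // x Bx; exact: smooth_cont Bx.
have sGW : smooth_on W G by apply: smooth_sub sG => x [].
have WV : forall x, W x -> V (G x) by move=> x [].
exists W, (E \o G); split.
- split => //; first by rewrite /W /= subrr normr0 G0.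
  by move=> x [/ballU].
- exact: (smooth_comp oW frameK frameK oV WV sGW sE).
- by move=> x /WV /En0.
- move=> x Wx; have [Bx Vx] := Wx.
  rewrite (@d1_chain _ G E); [|exact: smooth_diff Wx|exact: smooth_diff Vx].
  by rewrite E1 // G1 // mulrC.
Qed.

End LinearODE.

(** * Iterates of a first order operator *)

Section Monomials.
Variable K : numFieldType.

Lemma smooth_monomial (U : set K) c i : smooth_on U (fun t : K => (t - c) ^+ i).
Proof.
apply: (@smooth_sub _ _ setT) => //; apply: smoothX; first exact: openT.
by apply: smoothB; [exact: openT|exact: smooth_id|exact: smooth_cst].
Qed.

Lemma dn_monomial (c : K) i k t :
  derive1n k (fun t : K => (t - c) ^+ i) t = (i ^_ k)%:R * (t - c) ^+ (i - k).
Proof.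
elim: k t => [|k IH] t; first by rewrite ffactn0 mul1r subn0.
have sm j := smooth_diff (@smooth_monomial setT c j) (I : [set: K] t).
rewrite derive1nS (d1_ext openT (I : [set: K] t) (fun t _ => IH t)).
rewrite d1_mul; [|exact: differentiable_cst|exact: sm].
rewrite d1_cst mul0r add0r.
rewrite ffactnSr natrM -mulrA; congr (_ * _); rewrite subnS.
elim: (i - k)%N => [|j IHj]; first by rewrite mul0r d1_cst.
have -> : (fun t => (t - c) ^+ j.+1) = (fun t => (t - c) * (t - c) ^+ j).
  by apply/funext => y; rewrite exprS.
have dl : differentiable (fun z : K => z - c) t by exact: differentiableB.
rewrite d1_mul // d1_add // d1_id d1_cst addr0 mul1r IHj.
case: j {IHj} => [|j]; first by rewrite mul0r mulr0 addr0 mul1r.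
by rewrite [_.-1]/= mulrCA -exprS -[in RHS]natr1 mulrDl mul1r addrC.
Qed.

Lemma dn_monomial_at (c : K) i k :
  derive1n k (fun t : K => (t - c) ^+ i) c = if k == i then (i`!)%:R else 0.
Proof.
rewrite dn_monomial subrr; case: ltngtP => [ki|ik|->].
- by rewrite expr0n subn_eq0 leqNgt ki mulr0.
- by rewrite ffact_small // mul0r.
- by rewrite ffactnn subnn expr0 mulr1.
Qed.

Lemma fact_neq0 i : (i`!)%:R != 0 :> K.
Proof. by rewrite pnatr_eq0 -lt0n fact_gt0. Qed.

End Monomials.

Section Operators.
Variable K : numFieldType.
Implicit Types (U : set K) (f g p w : K -> K).

Lemma dn_add U f g k : open U -> smooth_on U f -> smooth_on U g ->
  forall x, U x -> derive1n k (fun y => f y + g y) x = derive1n k f x + derive1n k g x.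
Proof.
move=> oU sf sg; elim: k => [//|k IH] x Ux.
rewrite !derive1nS (d1_ext oU Ux IH) d1_add //.
- exact: smooth_diff (smooth_dn k oU sf) Ux.
- exact: smooth_diff (smooth_dn k oU sg) Ux.
Qed.

Lemma dn_sum U (I : Type) (s : seq I) (f : I -> K -> K) k : open U ->
  (forall i, smooth_on U (f i)) ->
  forall x, U x -> derive1n k (fun y => \sum_(i <- s) f i y) x
    = \sum_(i <- s) derive1n k (f i) x.
Proof.
move=> oU sf; elim: s => [|i s IH] x Ux.
  rewrite big_nil (@dn_ext _ _ U _ (fun=> 0) k oU _ x Ux); last first.
    by move=> y _; rewrite big_nil.
  elim: k => [//|k IHk]; rewrite derive1Sn.
  by have -> : derive1 (fun=> (0 : K)) = fun=> 0 by apply/funext => y; exact: d1_cst.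
rewrite big_cons -IH // -(@dn_add U) //; last exact: smooth_sum.
by apply: (dn_ext k oU _ Ux) => y _; rewrite big_cons.
Qed.

Section Psi.
Variables (U : set K) (r s : K -> K).
Hypotheses (oU : open U) (sr : smooth_on U r) (ss : smooth_on U s).
Hypothesis r0 : forall x, U x -> r x != 0.
Local Notation Psi := (Psi_op r s).

Lemma psi_smooth U' w : open U' -> U' `<=` U -> smooth_on U' w -> smooth_on U' (Psi w).
Proof.
move=> oU' sU sw; apply: smoothD => //; apply: smoothM => //.
- exact: smooth_sub sU sr.
- exact: smooth_d1.
- exact: smooth_sub sU ss.
Qed.

Lemma iter_psi_smooth n U' w : open U' -> U' `<=` U -> smooth_on U' w ->
  smooth_on U' (iter n Psi w).
Proof. by move=> oU' sU sw; elim: n => [//|n IH]; exact: psi_smooth. Qed.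

Lemma iter_psi_ext n U' f g : open U' -> (forall x, U' x -> f x = g x) ->
  forall x, U' x -> iter n Psi f x = iter n Psi g x.
Proof.
move=> oU' fg; elim: n => [//|n IH] x Ux /=.
by rewrite /Psi_op IH // (d1_ext oU' Ux IH).
Qed.

Lemma iter_psi_add n U' f g : open U' -> U' `<=` U -> smooth_on U' f -> smooth_on U' g ->
  forall x, U' x -> iter n Psi (fun y => f y + g y) x = iter n Psi f x + iter n Psi g x.
Proof.
move=> oU' sU sf sg; elim: n => [//|n IH] x Ux /=.
rewrite {1}/Psi_op (d1_ext oU' Ux IH) IH // d1_add; first by rewrite /Psi_op; ring.
- exact: smooth_diff (iter_psi_smooth n oU' sU sf) Ux.
- exact: smooth_diff (iter_psi_smooth n oU' sU sg) Ux.
Qed.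

(** Pushing one factor of Psi at a time through the product p * w keeps the
    coefficients unspecified, so that the induction needs no smoothness of the
    coefficients; only the two leading ones are tracked. *)
Lemma iter_psi_expand n p : smooth_on U p -> exists c : nat -> K -> K,
  [/\ forall U' w, open U' -> U' `<=` U -> smooth_on U' w -> forall x, U' x ->
        iter n Psi (fun y => p y * w y) x
          = \sum_(0 <= j < n.+1) c j x * derive1n (n - j) w x,
      forall x, U x -> c 0%N x = r x ^+ n * p x &
      forall x, U x -> c 1%N x = r x ^+ n.-1 * (n%:R * r x * derive1 p x
        + (n%:R * s x + 'C(n, 2)%:R * derive1 r x) * p x)].
Proof.
elim: n p => [|n IH] p sp.
  exists (fun j x => if j is 0%N then p x else 0); split.
  - by move=> U' w _ _ _ x _; rewrite big_nat1.
  - by move=> x _; rewrite expr0 mul1r.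
  - by move=> x _; rewrite bin0n /=; ring.
have sp' := smooth_d1 oU sp; have sr' := smooth_d1 oU sr.
pose p1 y := r y * derive1 p y + s y * p y; pose p2 y := r y * p y.
have sp1 : smooth_on U p1 by apply: smoothD => //; apply: smoothM.
have sp2 : smooth_on U p2 by apply: smoothM.
have [c1 [E1 c10 c11]] := IH _ sp1; have [c2 [E2 c20 c21]] := IH _ sp2.
exists (fun j x => (if (j <= n)%N then c2 j x else 0) +
                   (if j is j'.+1 then c1 j' x else 0)); split.
- move=> U' w oU' sU sw x Ux.
  have sub g : smooth_on U g -> smooth_on U' g by exact: smooth_sub.
  have sw' := smooth_d1 oU' sw.
  rewrite iterSr (@iter_psi_ext n U' _ (fun y => p1 y * w y + p2 y * derive1 w y)) //.
    rewrite (@iter_psi_add n U') //; try by apply: smoothM => //; exact: sub.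
    rewrite (E1 U') // (E2 U') //.
    rewrite [RHS](eq_bigr (fun j => (if (j <= n)%N then c2 j x else 0) * derive1n (n.+1 - j) w x
      + (if j is j'.+1 then c1 j' x else 0) * derive1n (n.+1 - j) w x)); last first.
      by move=> j _; rewrite mulrDl.
    rewrite big_split /= [in RHS]big_nat_recr //= ltnn mul0r addr0.
    rewrite [X in _ = _ + X]big_nat_recl //= mul0r add0r addrC; congr (_ + _).
    rewrite !big_nat; apply: eq_bigr => j /andP[_]; rewrite ltnS => jn.
    by rewrite jn subSn // derive1Sn.
  move=> y Uy; have dp := smooth_diff (sub _ sp) Uy; have dw := smooth_diff sw Uy.
  by rewrite /Psi_op d1_mul // /p1 /p2; ring.
- by move=> x Ux; rewrite /= addr0 c20 // /p2 exprSr mulrA.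
- move=> x Ux /=; rewrite c10 // /p1.
  have dr := smooth_diff sr Ux; have dp := smooth_diff sp Ux.
  case: n {IH E1 E2 c10 c20 c11} c21 => [|n] c21; first by rewrite /= (bin_small (ltnSn 1)); ring.
  rewrite ltnS leq0n c21 // /p2 d1_mul // (binS n.+1) bin1 natrD.
  rewrite -[n.+2%:R]natr1 [n.+1.-1]/= [r x ^+ n.+1]exprS; ring.
Qed.

(** The inverse expansion: derivatives of p * w are combinations of the iterates
    of Psi on w, because w' = (Psi w - s w) / r. *)
Lemma dn_expand_psi k p : smooth_on U p -> exists c : nat -> K -> K,
  (forall U' w, open U' -> U' `<=` U -> smooth_on U' w -> forall x, U' x ->
    derive1n k (fun y => p y * w y) x = \sum_(0 <= j < k.+1) c j x * iter j Psi w x) /\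
  (forall x, U x -> c k x = p x / r x ^+ k).
Proof.
elim: k p => [|k IH] p sp.
  exists (fun _ x => p x); split.
  - by move=> U' w _ _ _ x _; rewrite big_nat1.
  - by move=> x _; rewrite expr0 divr1.
have sp' := smooth_d1 oU sp.
have sV : smooth_on U (fun x => (r x)^-1) by exact: smoothV.
pose p2 y := p y / r y; pose p1 y := derive1 p y - p2 y * s y.
have sp2 : smooth_on U p2 by apply: smoothM.
have sp1 : smooth_on U p1 by apply: smoothB => //; apply: smoothM.
have [c1 [E1 _]] := IH _ sp1; have [c2 [E2 c2k]] := IH _ sp2.
exists (fun j x => (if (j <= k)%N then c1 j x else 0) +
                   (if j is j'.+1 then c2 j' x else 0)); split; last first.
  move=> x Ux; rewrite ltnn add0r c2k // /p2.
  by rewrite exprS; field; rewrite r0 // expf_neq0 // r0.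
move=> U' w oU' sU sw x Ux.
have sub g : smooth_on U g -> smooth_on U' g by exact: smooth_sub.
have sPw := psi_smooth oU' sU sw.
rewrite derive1Sn.
rewrite (@dn_ext _ _ U' _ (fun y => p1 y * w y + p2 y * Psi w y)) //.
  rewrite (@dn_add U') //; try by apply: smoothM => //; exact: sub.
  rewrite (E1 U') // (E2 U') //.
  rewrite [RHS](eq_bigr (fun j => (if (j <= k)%N then c1 j x else 0) * iter j Psi w x
    + (if j is j'.+1 then c2 j' x else 0) * iter j Psi w x)); last first.
    by move=> j _; rewrite mulrDl.
  rewrite big_split /= [in RHS]big_nat_recr //= ltnn mul0r addr0.
  rewrite [X in _ = _ + X]big_nat_recl //= mul0r add0r; congr (_ + _).
    by rewrite !big_nat; apply: eq_bigr => j /andP[_]; rewrite ltnS => ->.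
  by apply: eq_bigr => j _; rewrite -iterSr.
move=> y Uy; have dp := smooth_diff (sub _ sp) Uy; have dw := smooth_diff sw Uy.
rewrite d1_mul // /p1 /p2 /Psi_op; field; rewrite r0 //; exact: sU.
Qed.

(** Conjugating by a solution of Psi h = 0 and straightening r d/dx turns the
    iterates of Psi into iterated derivatives. *)
Lemma iter_psi_conj (W A : set K) (h phi v : K -> K) n : open W -> W `<=` U -> open A ->
  smooth_on W h -> smooth_on W phi -> (forall x, W x -> A (phi x)) -> smooth_on A v ->
  (forall x, W x -> Psi h x = 0) -> (forall x, W x -> derive1 phi x = (r x)^-1) ->
  forall x, W x -> iter n Psi (fun y => h y * v (phi y)) x = h x * derive1n n v (phi x).
Proof.
move=> oW sW oA sh sphi phiA sv h0 phi1.
elim: n => [//|n IH] x Wx /=.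
have Ax := phiA x Wx; have rx := r0 (sW x Wx).
have dv := smooth_diff (smooth_dn n oA sv) Ax.
have dphi := smooth_diff sphi Wx; have dh := smooth_diff sh Wx.
have dc : differentiable (fun y => derive1n n v (phi y)) x.
  exact: (@differentiable_comp _ _ _ _ phi (derive1n n v)).
rewrite {1}/Psi_op (d1_ext oW Wx IH) IH // d1_mul //.
rewrite (@d1_chain _ phi (derive1n n v)) // phi1 //.
have := h0 x Wx; rewrite /Psi_op => H.
have -> : r x * (derive1 h x * derive1n n v (phi x)
   + h x * (derive1 (derive1n n v) (phi x) * (r x)^-1))
   + s x * (h x * derive1n n v (phi x)) =
   (r x * derive1 h x + s x * h x) * derive1n n v (phi x)
   + h x * derive1 (derive1n n v) (phi x) by field.
by rewrite H mul0r add0r -derive1nS.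
Qed.

End Psi.
End Operators.

(** * Linear systems in coordinates *)

Section VectorValued.
Variable K : numFieldType.

Lemma entry_d1 m p (y : K -> 'M[K]_(m, p)) x i j : differentiable y x ->
  (derive1 y x) i j = derive1 (fun t => y t i j) x.
Proof.
move=> dy; rewrite !derive1E.
exact: (esym (@derive_linear K K _ K (entry i j) y x 1 (@coord_continuous K m p i j) dy)).
Qed.

Lemma entry_dn (U : set K) m p (y : K -> 'M[K]_(m, p)) k i j : open U -> smooth_on U y ->
  forall x, U x -> (derive1n k y x) i j = derive1n k (fun t => y t i j) x.
Proof.
move=> oU sy; elim: k => [//|k IH] x Ux.
rewrite !derive1nS entry_d1; last exact: smooth_diff (smooth_dn k oU sy) Ux.
exact: d1_ext oU Ux IH.
Qed.

Section LinOp.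
Variables (m n : nat).
Implicit Types (B A : nat -> K -> 'M[K]_m) (y w : K -> 'cV[K]_m).

Lemma lin_op_entry (U : set K) B y i : open U -> smooth_on U y -> forall x, U x ->
  (lin_op n B y x) i 0 = derive1n n (fun t => y t i 0) x +
    \sum_(1 <= k < n.+1) \sum_l B k x i l * derive1n (n - k) (fun t => y t l 0) x.
Proof.
move=> oU sy x Ux; rewrite /lin_op mxE (entry_dn n i 0 oU sy Ux) summxE.
congr (_ + _); apply: eq_bigr => k _; rewrite mxE; apply: eq_bigr => l _.
by rewrite (entry_dn _ l 0 oU sy Ux).
Qed.

Lemma lin_op_ext (U : set K) B y w : open U -> (forall x, U x -> y x = w x) ->
  forall x, U x -> lin_op n B y x = lin_op n B w x.
Proof.
move=> oU yw x Ux; rewrite /lin_op (dn_ext n oU yw Ux); congr (_ + _).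
by apply: eq_bigr => k _; rewrite (dn_ext _ oU yw Ux).
Qed.

Lemma lin_op0 y x : lin_op n (fun _ _ => 0 : 'M[K]_m) y x = derive1n n y x.
Proof. by rewrite /lin_op big1 ?addr0 // => k _; rewrite mul0mx. Qed.

(** The coefficients kap are only given through their action on smooth
    functions.  On (t - x) ^ n at x, only the leading one survives. *)
Lemma leading_iter_coef (U : set K) (r s : K -> K) (kap : nat -> K -> K) :
  open U -> smooth_on U r -> smooth_on U s ->
  iter_coefs_on n U r s kap -> forall x, U x -> kap 0%N x = r x ^+ n.
Proof.
move=> oU sr ss Hk x Ux.
have [c [Ec c0 _]] := iter_psi_expand oU sr ss n (smooth_cst U (1 : K)).
have sw := @smooth_monomial K U x n.
have ev (d : nat -> K -> K) :
    \sum_(0 <= j < n.+1) d j x * derive1n (n - j) (fun t => (t - x) ^+ n) x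
    = d 0%N x * (n`!)%:R.
  rewrite big_nat_recl // big_nat big1 ?addr0; last first.
    move=> j /andP[_ jn]; rewrite dn_monomial_at ifF ?mulr0 //.
    by rewrite ltn_eqF // ltn_subrL /= (leq_ltn_trans _ jn).
  by rewrite subn0 dn_monomial_at eqxx.
have := Hk U _ oU (@subset_refl _ U) sw x Ux; rewrite ev => E1.
have := Ec U _ oU (@subset_refl _ U) sw x Ux; rewrite ev c0 // mulr1 => E2.
apply: (mulIf (fact_neq0 K n)); rewrite -E1 -E2.
by apply: (iter_psi_ext r s n oU _ Ux) => y _; rewrite mul1r.
Qed.

(** Divided by r ^ n, the two leading coefficients of the iterate become 1 and 0,
    those of a system in normal form. *)
Lemma lin_op_iterative (U : set K) (r s : K -> K) (kap a : nat -> K -> K) A :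
  (2 <= n)%N -> open U -> smooth_on U r -> smooth_on U s ->
  (forall x, U x -> r x != 0) -> iter_coefs_on n U r s kap ->
  (forall x, U x -> kap 1%N x = 0) ->
  (forall j, (2 <= j <= n)%N -> forall x, U x -> a j x = kap j x / r x ^+ n) ->
  (forall x, U x -> A 1%N x = 0) ->
  (forall j, (2 <= j <= n)%N -> forall x, U x -> A j x = (a j x)%:M) ->
  forall U' w, open U' -> U' `<=` U -> smooth_on U' w -> forall x, U' x -> forall i,
  (lin_op n A w x) i 0 = iter n (Psi_op r s) (fun t => w t i 0) x / r x ^+ n.
Proof.
move=> n2 oU sr ss r0 Hk k1 ak A1 Ak U' w oU' sU sw x U'x i.
have Ux := sU x U'x; have rn0 : r x ^+ n != 0 by rewrite expf_neq0 // r0.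
rewrite (lin_op_entry A i oU' sw U'x).
rewrite (Hk U' _ oU' sU (smooth_entry oU' i 0 sw) x U'x).
have n1 : (1 < n.+1)%N by rewrite ltnS ltnW.
rewrite [in LHS](big_ltn n1) (big_ltn (ltn0Sn n)) (big_ltn n1).
rewrite k1 // mul0r add0r big1 ?add0r; last first.
  by move=> l _; rewrite A1 // mxE mul0r.
rewrite (leading_iter_coef oU sr ss Hk) // subn0 mulrDl mulrAC divff // mul1r.
congr (_ + _); rewrite mulr_suml !big_nat; apply: eq_bigr => k kn.
have kn' : (2 <= k <= n)%N by [].
rewrite (bigD1 i) //= Ak // ak // big1 ?addr0; last first.
  by move=> l li; rewrite mxE eq_sym (negbTE li) mulr0n mul0r.
by rewrite mxE eqxx mulr1n mulrAC.
Qed.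

End LinOp.

Section SmoothMatrices.
Variables (V : normedModType K) (U : set V) (oU : open U).

Lemma smooth_prod (I : Type) (s : seq I) (f : I -> V -> K) :
  (forall i, smooth_on U (f i)) -> smooth_on U (fun x => \prod_(i <- s) f i x).
Proof.
move=> sf; elim: s => [|i s IH].
  apply: (smooth_ext oU _ (smooth_cst U (1 : K))) => x _; by rewrite big_nil.
by apply: (smooth_ext oU _ (smoothM oU (sf i) IH)) => x _; rewrite big_cons.
Qed.

Lemma smooth_det m (M : V -> 'M[K]_m) :
  (forall i j, smooth_on U (fun x => M x i j)) -> smooth_on U (fun x => \det (M x)).
Proof.
move=> sM; apply: smooth_sum => // s; apply: smoothM => //; first exact: smooth_cst.
exact: smooth_prod.
Qed.

Lemma smooth_invmx m (M : V -> 'M[K]_m) i j : (forall x, U x -> M x \in unitmx) ->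
  (forall i j, smooth_on U (fun x => M x i j)) ->
  smooth_on U (fun x => invmx (M x) i j).
Proof.
move=> uM sM.
have sadj : smooth_on U (fun x => (\adj (M x)) i j).
  have -> : (fun x => (\adj (M x)) i j) = fun x => cofactor (M x) j i.
    by apply/funext => x; rewrite mxE.
  apply: smoothM => //; first exact: smooth_cst.
  apply: smooth_det => k l.
  have -> : (fun x => row' j (col' i (M x)) k l) = fun x => M x (lift j k) (lift i l).
    by apply/funext => x; rewrite !mxE.
  exact: sM.
have sdet : smooth_on U (fun x => (\det (M x))^-1).
  by apply: smoothV => //; [move=> x /uM; rewrite unitmxE unitfE|exact: smooth_det].
apply: (smooth_ext oU _ (smoothM oU sdet sadj)) => x Ux.
by rewrite /invmx uM // !mxE.
Qed.

End SmoothMatrices.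
End VectorValued.

(** * From an iterative normal form to a point transformation *)

Section Sufficiency.
Variables (K : numFieldType) (HK : geometrically_complete K) (m n : nat).
Hypothesis n2 : (2 <= n)%N.

(** The point transformation is x = psi z, y = h (psi z) Q (psi z) w, with h a
    solution of r h' + s h = 0 and psi the inverse of a primitive of 1 / r. *)
Lemma normal_form_reducible (D U : set K) (B A : nat -> K -> 'M[K]_m)
    (a : nat -> K -> K) (x0 : K) :
  open U -> U x0 -> U `<=` D -> normal_form_on n U B A ->
  (forall k, (2 <= k <= n)%N -> forall x, U x -> A k x = (a k x)%:M) ->
  iterative_on n U a -> reducible_at n D B x0.
Proof.
move=> oU Ux0 UD [Q [sQ uQ _ A1 nf]] Ak [r [s [kap [[sr ss] r0 Hk k1 ak]]]].
have sV := smoothV oU r0 sr.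
have sq : smooth_on U (fun x => - s x / r x) by apply: smoothM => //; exact: smoothN.
have [U1 [h [[oU1 U1x0 U1U] sh h0 h1]]] := local_linear_ode HK oU sq Ux0.
have sV1 := smooth_sub U1U sV.
have [rho [phi [rho0 ballU1 sphi phi1 _]]] := local_primitive HK oU1 sV1 U1x0.
pose W0 := [set z | `|z - x0| < rho].
have oW0 : open W0 := open_norm_ball x0 rho.
have W0x0 : W0 x0 by rewrite /W0 /= subrr normr0.
have [|W [Z [psi [[oW Wx0 WW0] [oZ _ spsi] [phiZ psiW psiK phiK] _ _]]]] :=
  local_inverse HK oW0 sphi W0x0.
  by rewrite phi1 // invr_neq0 // r0.
have WU1 : W `<=` U1 by move=> x /WW0 /ballU1.
have WU : W `<=` U by move=> x /WU1 /U1U.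
have sphiW := smooth_sub WW0 sphi; have shW := smooth_sub WU1 sh.
pose Om := [set p : K * 'cV[K]_m | Z p.1].
pose Om' := [set p : K * 'cV[K]_m | W p.1].
have oOm : open Om by apply: open_comp => // x _; exact: cvg_fst.
have oOm' : open Om' by apply: open_comp => // x _; exact: cvg_fst.
pose Phi (p : K * 'cV[K]_m) : K * 'cV[K]_m :=
  (psi p.1, h (psi p.1) *: (Q (psi p.1) *m p.2)).
pose Phi' (p : K * 'cV[K]_m) : K * 'cV[K]_m :=
  (phi p.1, (h p.1)^-1 *: (invmx (Q p.1) *m p.2)).
have ssnd (X : set (K * 'cV[K]_m)) (oX : open X) i : smooth_on X (fun p => p.2 i 0).
  by apply: smooth_entry => //; exact: smooth_on_snd.
have pull (X : set (K * 'cV[K]_m)) (Y : set K) (g : K -> K) : open X -> open Y ->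
    (forall p, X p -> Y p.1) -> smooth_on Y g -> smooth_on X (fun p => g p.1).
  move=> oX oY XY sg.
  exact: (@smooth_comp _ _ X oX _ _ frameK frameK Y fst g oY XY (@smooth_on_fst _ K 'cV[K]_m X) sg).
have smul (X : set (K * 'cV[K]_m)) (Y : set K) (g : K -> K) (M : K -> 'M[K]_m) :
    open X -> open Y -> (forall p, X p -> Y p.1) -> smooth_on Y g ->
    (forall i j, smooth_on Y (fun x => M x i j)) ->
    smooth_on X (fun p => g p.1 *: (M p.1 *m p.2)).
  move=> oX oY XY sg sM; apply: smooth_mx => // i j.
  apply: (@smooth_ext _ _ _ oX _ (fun p => g p.1 * \sum_l M p.1 i l * p.2 l 0)).
    by move=> p _; rewrite !mxE ord1.
  apply: smoothM => //; first exact: (pull _ Y).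
  apply: smooth_sum => // l; apply: smoothM => //; last exact: ssnd.
  exact: (pull _ Y _ oX oY XY (sM i l)).
have sQW i j : smooth_on W (fun x => Q x i j).
  exact: (smooth_entry oW i j (smooth_sub WU sQ)).
have onZ (g : K -> K) : smooth_on W g -> smooth_on Z (fun z => g (psi z)).
  exact: (@smooth_comp _ _ Z oZ _ _ frameK frameK W psi g oW psiW spsi).
have uQW x : W x -> Q x \in unitmx by move=> /WU /uQ.
have hW0 x : W x -> h x != 0 by move=> /WU1 /h0.
exists Om, Om', Phi, Phi'; split.
- split; split => //.
  + apply: (smooth_pair oOm frameK (frameM m 1)); first exact: (pull _ Z).
    apply: (smul _ Z (fun z => h (psi z)) (fun z => Q (psi z))) => //.
      exact: onZ.
    by move=> i j; exact: onZ (sQW i j).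
  + apply: (smooth_pair oOm' frameK (frameM m 1)); first exact: (pull _ W).
    apply: (smul _ W (fun x => (h x)^-1) (fun x => invmx (Q x))) => //.
      exact: smoothV.
    by move=> i j; exact: smooth_invmx.
  + by move=> p /= /psiW.
  + by move=> p /= /phiZ.
  + move=> [z w] /= Zz; rewrite /Phi /Phi' /= phiK //; congr (_, _).
    have Wz := psiW z Zz.
    by rewrite -scalemxAr scalerA mulVf ?hW0 // scale1r mulKmx // uQW.
  + move=> [x y] /= Wx; rewrite /Phi /Phi' /= psiK //; congr (_, _).
    by rewrite -scalemxAr scalerA mulfV ?hW0 // scale1r mulKVmx // uQW.
- by move=> q /WU /UD.
- by exists 0.
move=> U2 V2 w y oU2 oV2 sw sy gOm gE.
have U2Z z : U2 z -> Z z by move=> Uz; apply: (gOm (z, w z)); exists z.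
have V2P x : V2 x -> [/\ W x, U2 (phi x) & y x = h x *: (Q x *m w (phi x))].
  move=> Vx; have : graph V2 y (x, y x) by exists x.
  rewrite -gE => -[_ [z Uz <-]] [<- <-].
  by rewrite phiK; [split => //; exact/psiW/U2Z|exact: U2Z].
have U2V z : U2 z -> V2 (psi z).
  move=> Uz; have : graph V2 y (Phi (z, w z)) by rewrite -gE; exists (z, w z) => //; exists z.
  by move=> [x Vx [<- _]].
have V2W : V2 `<=` W by move=> x /V2P[].
have V2U : V2 `<=` U by move=> x /V2W /WU.
pose om t := h t *: w (phi t).
have som : smooth_on V2 om.
  apply: smooth_mx => // i j.
  apply: (@smooth_ext _ _ _ oV2 _ (fun t => h t * w (phi t) i j)).
    by move=> t _; rewrite mxE.
  apply: smoothM => //; first exact: smooth_sub V2W shW.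
  have swij := smooth_entry oU2 i j sw.
  apply: (@smooth_comp _ _ V2 oV2 _ _ frameK frameK U2 phi _ oU2 _ _ swij).
    by move=> x /V2P[].
  exact: smooth_sub V2W sphiW.
have key x : V2 x -> lin_op n B y x = (h x / r x ^+ n) *: (Q x *m derive1n n w (phi x)).
  move=> Vx; have [Wx Upx yx] := V2P x Vx.
  rewrite (@lin_op_ext K m n V2 B y (fun t => Q t *m om t) oV2 _ x Vx); last first.
    by move=> t /V2P[_ _ ->]; rewrite -scalemxAr.
  rewrite (nf V2 om oV2 V2U som x Vx) [RHS]scalemxAr; congr (_ *m _).
  apply/matrixP => i j; rewrite ord1 {j}.
  rewrite (lin_op_iterative n2 oU sr ss r0 Hk k1 ak A1 Ak oV2 V2U som Vx).
  rewrite mxE (entry_dn n i 0 oU2 sw Upx) mulrAC; congr (_ / _).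
  have swi := smooth_entry oU2 i 0 sw.
  have H := @iter_psi_conj K U r s r0 V2 U2 h phi (fun z => w z i 0) n oV2 V2U oU2.
  rewrite -H //.
  - by apply: (iter_psi_ext r s n oV2 _ Vx) => t _; rewrite mxE.
  - exact: smooth_sub V2W shW.
  - exact: smooth_sub V2W sphiW.
  - by move=> t /V2P[].
  - move=> t Vt; rewrite /Psi_op h1; last exact/WU1/V2W.
    by field; rewrite r0 //; exact: V2U.
  - by move=> t Vt; rewrite phi1 //; exact/WW0/V2W.
split=> [sB z Uz|s0 x Vx]; last first.
  have [Wx Upx _] := V2P x Vx; rewrite key //.
  by have := s0 _ Upx; rewrite lin_op0 => ->; rewrite mulmx0 scaler0.
have Vx := U2V z Uz; have := sB _ Vx; rewrite key // phiK; last exact: U2Z.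
have Wx := V2W _ Vx.
move=> /eqP; rewrite scaler_eq0 mulf_eq0 invr_eq0 expf_eq0 (negbTE (hW0 _ Wx)).
rewrite (negbTE (r0 _ (V2U _ Vx))) andbF /= => /eqP H.
by rewrite lin_op0 -[LHS](mulKmx (uQW _ Wx)) H mulmx0.
Qed.

End Sufficiency.

(** * Variation of a family of solutions *)

Section Family.
Variables (K : numFieldType) (HK : geometrically_complete K).
Variables (U : set (K * K)) (phi : K * K -> K).
Hypotheses (oU : open U) (sphi : smooth_on U phi).

Definition d_z (g : K * K -> K) : K * K -> K := 'D_((1, 0) : K * K) g.
Definition d_e (g : K * K -> K) : K * K -> K := 'D_((0, 1) : K * K) g.

Hypothesis phi0 : forall p, U p -> d_z phi p != 0.

(** In the coordinates (x, e) = (phi (z, e), e) these two operators are the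
    partial derivatives with respect to x and to e. *)
Definition along_x (g : K * K -> K) : K * K -> K := fun p => d_z g p / d_z phi p.
Definition along_e (g : K * K -> K) : K * K -> K :=
  fun p => d_e g p - d_e phi p * along_x g p.

Lemma Dv_ext (f g : K * K -> K) v : (forall p, U p -> f p = g p) ->
  forall p, U p -> 'D_v f p = 'D_v g p.
Proof. by move=> fg p Up; apply: near_eq_derive; exact: eq_on_near oU Up fg. Qed.

Lemma along_x_ext f g : (forall p, U p -> f p = g p) ->
  forall p, U p -> along_x f p = along_x g p.
Proof. by move=> fg p Up; rewrite /along_x /d_z (Dv_ext _ fg). Qed.

Lemma along_e_ext f g : (forall p, U p -> f p = g p) ->
  forall p, U p -> along_e f p = along_e g p.
Proof.
by move=> fg p Up; rewrite /along_e (along_x_ext fg) // /d_e (Dv_ext _ fg).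
Qed.

Lemma smooth_along_x g : smooth_on U g -> smooth_on U (along_x g).
Proof.
move=> sg; apply: smoothM => //; first exact: smooth_derive.
by apply: smoothV => //; exact: smooth_derive.
Qed.

Lemma smooth_along_e g : smooth_on U g -> smooth_on U (along_e g).
Proof.
move=> sg; apply: smoothB => //; first exact: smooth_derive.
by apply: smoothM => //; [exact: smooth_derive|exact: smooth_along_x].
Qed.

Lemma smooth_iter_x k g : smooth_on U g -> smooth_on U (iter k along_x g).
Proof. by move=> sg; elim: k => [//|k IH]; exact: smooth_along_x. Qed.

(** Partial derivatives in the coordinates (x, e) commute; in the coordinates
    (z, e) this is the symmetry of the second derivatives of g and of phi. *)
Lemma along_ex g : smooth_on U g -> forall p, U p ->
  along_e (along_x g) p = along_x (along_e g) p.
Proof.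
move=> sg p Up; have z0 := phi0 Up.
have sz := smooth_derive ((1, 0) : K * K) sg; have se := smooth_derive ((0, 1) : K * K) sg.
have spz := smooth_derive ((1, 0) : K * K) sphi.
have spe := smooth_derive ((0, 1) : K * K) sphi.
have sx := smooth_along_x sg.
have Sg := schwarz HK oU sg Up; have Sp := schwarz HK oU sphi Up.
have spV : smooth_on U (fun p => (d_z phi p)^-1) by exact: smoothV.
have sm : smooth_on U (fun p => d_e phi p * along_x g p) by exact: smoothM.
have smN : smooth_on U (fun p => - (d_e phi p * along_x g p)) by exact: smoothN.
have Ee : d_e (along_x g) p =
    d_e (d_z g) p / d_z phi p - d_z g p * d_e (d_z phi) p / d_z phi p ^+ 2.
  rewrite {1}/d_e /along_x Dv_mul; [|exact: smooth_diff sz Up|exact: smooth_diff spV Up].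
  rewrite (Dv_inv _ z0 (smooth_diff spz Up)) -/(d_e (d_z g) p) -/(d_e (d_z phi) p).
  by rewrite mulNr mulrN mulrA.
have Ez : d_z (along_e g) p = d_z (d_e g) p -
    (d_z (d_e phi) p * along_x g p + d_e phi p * d_z (along_x g) p).
  rewrite {1}/d_z /along_e Dv_add; [|exact: smooth_diff se Up|exact: smooth_diff smN Up].
  congr (_ + _).
  have -> : (fun p => - (d_e phi p * along_x g p)) = - (fun p => d_e phi p * along_x g p) by [].
  rewrite deriveN; last exact/diff_derivable/(smooth_diff sm Up).
  by rewrite Dv_mul; [|exact: smooth_diff spe Up|exact: smooth_diff sx Up].
have Sg' : d_e (d_z g) p = d_z (d_e g) p := Sg.
have Sp' : d_e (d_z phi) p = d_z (d_e phi) p := Sp.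
rewrite {1}/along_e {1}[along_x (along_e g)]/along_x Ee Ez Sg' Sp'.
rewrite [along_x (along_x g) p]/along_x [along_x g p]/along_x.
move: (d_z phi p) z0 (d_z (d_e g) p) (d_z g p) (d_z (d_e phi) p) (d_e phi p) => x x0 *.
by field.
Qed.

Lemma along_e_iter k g : smooth_on U g -> forall p, U p ->
  along_e (iter k along_x g) p = iter k along_x (along_e g) p.
Proof.
move=> sg; elim: k => [//|k IH] p Up.
rewrite iterS along_ex //; last exact: smooth_iter_x.
exact: along_x_ext.
Qed.

Lemma along_e_fun_phi (b : K -> K) (D : set K) : smooth_on D b ->
  (forall p, U p -> D (phi p)) -> forall p, U p -> along_e (fun p => b (phi p)) p = 0.
Proof.
move=> sb Dphi p Up; have z0 := phi0 Up.
have db := smooth_diff sb (Dphi p Up); have dp := smooth_diff sphi Up.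
rewrite /along_e /along_x {1}/d_e {1}/d_z !Dv_chain // -/(d_e phi p) -/(d_z phi p).
by field.
Qed.

Lemma along_e_add (f g : K * K -> K) : smooth_on U f -> smooth_on U g -> forall p, U p ->
  along_e (fun p => f p + g p) p = along_e f p + along_e g p.
Proof.
move=> sf sg p Up; have df := smooth_diff sf Up; have dg := smooth_diff sg Up.
by rewrite /along_e /along_x /d_e /d_z !(@Dv_add _ _ f g) //; ring.
Qed.

Lemma along_e_mul (f g : K * K -> K) : smooth_on U f -> smooth_on U g -> forall p, U p ->
  along_e (fun p => f p * g p) p = along_e f p * g p + f p * along_e g p.
Proof.
move=> sf sg p Up; have df := smooth_diff sf Up; have dg := smooth_diff sg Up.
by rewrite /along_e /along_x /d_e /d_z !(@Dv_mul _ _ f g) //; ring.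
Qed.

Lemma along_e_cst (a : K) p : along_e (fun=> a) p = 0.
Proof.
by rewrite /along_e /along_x /d_e /d_z !derive_cst mul0r mulr0 subrr.
Qed.

Lemma along_e_sum (I : Type) (s : seq I) (f : I -> K * K -> K) :
  (forall i, smooth_on U (f i)) -> forall p, U p ->
  along_e (fun p => \sum_(i <- s) f i p) p = \sum_(i <- s) along_e (f i) p.
Proof.
move=> sf; elim: s => [|i s IH] p Up.
  rewrite big_nil (@along_e_ext _ (fun=> 0) _ p Up) ?along_e_cst // => q _.
  by rewrite big_nil.
rewrite big_cons -IH // -along_e_add //; last exact: smooth_sum.
by apply: along_e_ext (Up) => q _; rewrite big_cons.
Qed.

(** A family of solutions of a linear system, differentiated with respect to
    its parameter at a fixed value of the independent variable, is again a
    solution, because along_e is a derivation that commutes with along_x and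
    annihilates the coefficients. *)
Lemma variation_solves m n (D : set K) (b : nat -> 'I_m -> 'I_m -> K -> K)
    (Y : 'I_m -> K * K -> K) :
  open D -> (forall k i l, (1 <= k <= n)%N -> smooth_on D (b k i l)) ->
  (forall p, U p -> D (phi p)) -> (forall i, smooth_on U (Y i)) ->
  (forall i p, U p -> iter n along_x (Y i) p +
    \sum_(1 <= k < n.+1) \sum_l b k i l (phi p) * iter (n - k) along_x (Y l) p = 0) ->
  forall i p, U p -> iter n along_x (along_e (Y i)) p +
    \sum_(1 <= k < n.+1) \sum_l b k i l (phi p)
       * iter (n - k) along_x (along_e (Y l)) p = 0.
Proof.
move=> oD sb Dphi sY eqn i p Up.
have sbphi k l : (1 <= k <= n)%N -> smooth_on U (fun p => b k i l (phi p)).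
  by move=> kn; exact: (@smooth_comp _ _ U oU _ _ frameK frameK D phi _ oD Dphi sphi (sb k i l kn)).
pose T k l p := (if (1 <= k <= n)%N then b k i l (phi p) else 0) * iter (n - k) along_x (Y l) p.
have sT k l : smooth_on U (T k l).
  apply: smoothM => //; last exact: smooth_iter_x.
  by case kn: (0 < k <= n)%N; [exact: sbphi|exact: smooth_cst].
have eqT q : U q -> iter n along_x (Y i) q + \sum_(1 <= k < n.+1) \sum_l T k l q = 0.
  move=> Uq; rewrite -[RHS](eqn i q Uq); congr (_ + _).
  rewrite !big_nat; apply: eq_bigr => k kn; apply: eq_bigr => l _.
  by rewrite /T ifT.
have := along_e_ext eqT Up; rewrite along_e_cst along_e_add //; last 2 first.
- exact: smooth_iter_x.
- by apply: smooth_sum => // k; apply: smooth_sum.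
rewrite along_e_iter // along_e_sum //; last by move=> k; exact: smooth_sum.
move=> E; rewrite -[RHS]E; congr (_ + _).
rewrite !big_nat; apply: eq_bigr => k kn; rewrite along_e_sum //.
apply: eq_bigr => l _; rewrite /T.
rewrite along_e_mul //; last exact: smooth_iter_x; last first.
  by rewrite kn; exact: sbphi.
by rewrite along_e_iter // kn (along_e_fun_phi (sb k i l kn)) // mul0r add0r.
Qed.

(** At a fixed parameter, along_x is differentiation with respect to x. *)
Lemma dn_slice (V : set K) (psi : K -> K) (e : K) (g : K * K -> K) k : open V ->
  smooth_on V psi -> (forall x, V x -> U (psi x, e)) ->
  (forall x, V x -> derive1 psi x = (derive1 (fun z => phi (z, e)) (psi x))^-1) ->
  smooth_on U g -> forall x, V x ->
  derive1n k (fun x => g (psi x, e)) x = iter k along_x g (psi x, e).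
Proof.
move=> oV spsi Upsi psi1 sg; elim: k => [//|k IH] x Vx.
rewrite derive1nS (d1_ext oV Vx IH).
have dg := smooth_diff (smooth_iter_x k sg) (Upsi x Vx).
rewrite (@d1_chain _ psi (fun z => iter k along_x g (z, e))); last 2 first.
- exact: smooth_diff spsi Vx.
- exact: differentiable_fst.
by rewrite psi1 // !derive1_fst.
Qed.

End Family.

(** * From power solutions to the normal form *)

Section MonomialProducts.
Variable K : numFieldType.

Lemma dn_scale (U : set K) (a : K) (f : K -> K) k : open U -> smooth_on U f ->
  forall x, U x -> derive1n k (fun t => a * f t) x = a * derive1n k f x.
Proof.
move=> oU sf; elim: k => [//|k IH] x Ux.
have df := smooth_diff (smooth_dn k oU sf) Ux.
by rewrite !derive1nS (d1_ext oU Ux IH) d1_mul // d1_cst mul0r add0r.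
Qed.

Lemma iter_psi_dn k (f : K -> K) x : iter k (Psi_op (fun=> 1) (fun=> 0)) f x = derive1n k f x.
Proof.
suff -> : Psi_op (fun=> 1) (fun=> 0) = @derive1 K K by [].
by apply/funext => g; apply/funext => y; rewrite /Psi_op mul1r mul0r addr0.
Qed.

(** Powers of (t - x) isolate, at x, the two leading terms of the derivatives of
    a product. *)
Lemma dn_mul_monomial (U : set K) (p : K -> K) x i : open U -> smooth_on U p -> U x ->
  [/\ forall k, (k < i)%N -> derive1n k (fun t => p t * (t - x) ^+ i) x = 0,
      derive1n i (fun t => p t * (t - x) ^+ i) x = p x * (i`!)%:R &
      derive1n i.+1 (fun t => p t * (t - x) ^+ i) x = i.+1%:R * derive1 p x * (i`!)%:R].
Proof.
move=> oU sp Ux.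
have exp k := @iter_psi_expand K U (fun=> 1) (fun=> 0) oU (smooth_cst U (1 : K))
  (smooth_cst U (0 : K)) k p sp.
have sw := @smooth_monomial K U x i.
split=> [k ki||].
- have [c [Ec _ _]] := exp k.
  rewrite -iter_psi_dn (Ec U _ oU (@subset_refl _ U) sw x Ux) big_nat big1 // => j _.
  by rewrite dn_monomial_at ltn_eqF ?mulr0 // (leq_ltn_trans (leq_subr _ _)).
- have [c [Ec c0 _]] := exp i.
  rewrite -iter_psi_dn (Ec U _ oU (@subset_refl _ U) sw x Ux) big_nat_recl // big_nat big1.
    by rewrite addr0 subn0 dn_monomial_at eqxx c0 // expr1n mul1r.
  move=> j /andP[_ ji]; rewrite dn_monomial_at ltn_eqF ?mulr0 //.
  by rewrite ltn_subrL /= (leq_ltn_trans _ ji).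
- have [c [Ec _ c1]] := exp i.+1.
  rewrite -iter_psi_dn (Ec U _ oU (@subset_refl _ U) sw x Ux) big_nat_recl // big_nat_recl //.
  rewrite big_nat big1 ?addr0.
    rewrite subn0 subn1 [i.+1.-1]/= dn_monomial_at gtn_eqF // mulr0 add0r.
    rewrite dn_monomial_at eqxx c1 //.
    by rewrite d1_cst expr1n; ring.
  move=> j /andP[_ ji]; rewrite dn_monomial_at ltn_eqF ?mulr0 //.
  by rewrite subSS ltn_subrL /= (leq_ltn_trans _ ji).
Qed.

End MonomialProducts.

Section NormalForm.
Variables (K : numFieldType) (HK : geometrically_complete K) (m n : nat).
Hypothesis n2 : (2 <= n)%N.

(** The iterates Psi^j w of a scalar w on the column q of Q = M / h separate: at
    x, the function h (psi - psi x) ^ j is annihilated by all of them but the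
    j-th, while the system annihilates Q applied to it.  So the system applied
    to Q w reduces to its leading term Q r^-n Psi^n w.  The condition
    B 1 Q + n Q' = 0 is then read off on (t - x) ^ (n - 1). *)
Lemma power_solutions_normal_form (V : set K) (B : nat -> K -> 'M[K]_m)
    (psi : K -> K) (M : K -> 'M[K]_m) x0 :
  open V -> V x0 -> smooth_on V psi -> (forall x, V x -> derive1 psi x != 0) ->
  (forall i j, smooth_on V (fun x => M x i j)) -> (forall x, V x -> M x \in unitmx) ->
  (forall c i q, (i < n)%N -> forall x, V x -> forall j,
    derive1n n (fun t => (psi t - c) ^+ i * M t j q) x +
    \sum_(1 <= k < n.+1) \sum_l
      B k x j l * derive1n (n - k) (fun t => (psi t - c) ^+ i * M t l q) x = 0) ->
  exists (U : set K) (A : nat -> K -> 'M[K]_m) (a : nat -> K -> K),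
    [/\ [/\ open U, U x0 & U `<=` V], normal_form_on n U B A,
        forall k, (2 <= k <= n)%N -> forall x, U x -> A k x = (a k x)%:M &
        iterative_on n U a].
Proof.
move=> oV Vx0 spsi psi0 sM uM sol.
pose r x := (derive1 psi x)^-1.
have srV : smooth_on V r by apply: smoothV => //; exact: smooth_d1.
(* The choice of s that makes the second coefficient of the n-th iterate vanish. *)
pose s x := - (n.-1%:R / 2) * derive1 r x.
have ssV : smooth_on V s by apply: smoothM => //; [exact: smooth_cst|exact: smooth_d1].
have r0V x : V x -> r x != 0 by move=> /psi0; rewrite invr_eq0.
have sq : smooth_on V (fun x => - s x / r x).
  by apply: smoothM => //; [exact: smoothN|exact: smoothV].
have [W [h [[oW Wx0 WV] sh h0 h1]]] := local_linear_ode HK oV sq Vx0.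
have sr := smooth_sub WV srV; have ss := smooth_sub WV ssV.
have r0 x : W x -> r x != 0 by move=> /WV /r0V.
have [kap [Ek k0 k1]] := iter_psi_expand oW sr ss n (smooth_cst W (1 : K)).
have Hk : iter_coefs_on n W r s kap.
  move=> U' w oU' sU sw z Uz; rewrite -(Ek U') //.
  by apply: (iter_psi_ext r s n oU' _ Uz) => y _; rewrite mul1r.
have k10 x : W x -> kap 1%N x = 0.
  move=> Wx; rewrite k1 // d1_cst mulr0 add0r /s bin2.
  case: n n2 => [//|n'] _; rewrite [n'.+1.-1]/=.
  have -> : (n'.+1 * n')./2%:R = n'.+1%:R * n'%:R / 2 :> K.
    have ev : ~~ odd (n'.+1 * n') by rewrite oddM /= andNb.
    have := odd_double_half (n'.+1 * n'); rewrite (negbTE ev) add0n => E.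
    by rewrite -natrM -{2}E -muln2 natrM mulfK // pnatr_eq0.
  by ring.
pose Q x := (h x)^-1 *: M x.
pose A k x : 'M[K]_m := if k == 1%N then 0 else (kap k x / r x ^+ n)%:M.
pose a k x := kap k x / r x ^+ n.
have sV : smooth_on W (fun x => (h x)^-1) by exact: smoothV.
have sQ i j : smooth_on W (fun x => Q x i j).
  apply: (smooth_ext oW _ (smoothM oW sV (smooth_sub WV (sM i j)))) => x _.
  by rewrite mxE.
have ak j : (2 <= j <= n)%N -> forall x, W x -> a j x = kap j x / r x ^+ n by [].
have A1 x : W x -> A 1%N x = 0 by [].
have Ak j : (2 <= j <= n)%N -> forall x, W x -> A j x = (a j x)%:M.
  by move=> /andP[j2 _] x _; rewrite /A gtn_eqF.
have col i q : forall U' w, open U' -> U' `<=` W -> smooth_on U' w -> forall x, U' x ->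
    derive1n n (fun t => Q t i q * w t) x +
    \sum_(1 <= k < n.+1) \sum_l B k x i l * derive1n (n - k) (fun t => Q t l q * w t) x
    = Q x i q * (iter n (Psi_op r s) w x / r x ^+ n).
  have /choice [cc ccP] : forall kl : nat * 'I_m, exists c : nat -> K -> K,
    (forall U' w, open U' -> U' `<=` W -> smooth_on U' w -> forall x, U' x ->
      derive1n kl.1 (fun y => Q y kl.2 q * w y) x
        = \sum_(0 <= j < kl.1.+1) c j x * iter j (Psi_op r s) w x) /\
    (forall x, W x -> c kl.1 x = Q x kl.2 q / r x ^+ kl.1).
    by move=> [k l]; exact: (dn_expand_psi oW sr ss r0 k (sQ l q)).
  pose C j x := cc (n, i) j x + \sum_(1 <= k < n.+1) \sum_l
    B k x i l * (if (j < (n - k).+1)%N then cc ((n - k)%N, l) j x else 0).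
  have expC U' w x : open U' -> U' `<=` W -> smooth_on U' w -> U' x ->
      derive1n n (fun t => Q t i q * w t) x + \sum_(1 <= k < n.+1) \sum_l
        B k x i l * derive1n (n - k) (fun t => Q t l q * w t) x
      = \sum_(0 <= j < n.+1) C j x * iter j (Psi_op r s) w x.
    move=> oU' sU sw Ux.
    rewrite [RHS](eq_bigr (fun j => cc (n, i) j x * iter j (Psi_op r s) w x +
      \sum_(1 <= k < n.+1) \sum_l B k x i l *
        ((if (j < (n - k).+1)%N then cc ((n - k)%N, l) j x else 0)
          * iter j (Psi_op r s) w x))); last first.
      move=> j _; rewrite mulrDl mulr_suml; congr (_ + _); apply: eq_bigr => k _.
      by rewrite mulr_suml; apply: eq_bigr => l _; rewrite mulrA.
    rewrite big_split /= -((ccP (n, i)).1 U' w) //; congr (_ + _).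
    rewrite [RHS]exchange_big /=; apply: eq_bigr => k _.
    rewrite [RHS]exchange_big /=; apply: eq_bigr => l _.
    rewrite -mulr_sumr; congr (_ * _).
    rewrite ((ccP ((n - k)%N, l)).1 U' w) //=.
    have nk : ((n - k).+1 <= n.+1)%N by rewrite ltnS leq_subr.
    rewrite [RHS](big_cat_nat (leq0n _) nk) /=.
    rewrite [X in _ = _ + X]big_nat [X in _ = _ + X]big1 ?addr0; last first.
      by move=> j /andP[kj _]; rewrite ltnNge kj /= mul0r.
    by rewrite !big_nat; apply: eq_bigr => j /andP[_ ->].
  have Cn x : W x -> C n x = Q x i q / r x ^+ n.
    move=> Wx; rewrite /C (ccP (n, i)).2 // big_nat big1 ?addr0 // => k /andP[k1' _].
    rewrite big1 // => l _; rewrite ltnS ifF ?mulr0 //.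
    apply/negbTE; rewrite -ltnNge ltn_subrL k1' /=.
    exact: leq_trans n2.
  (* The function h (psi - psi x) ^ j sees C j only, and is mapped to 0. *)
  have Cj j x : (j < n)%N -> W x -> C j x = 0.
    move=> jn Wx; pose c := psi x.
    pose w t := h t * (psi t - c) ^+ j.
    have spsiW := smooth_sub WV spsi.
    have sw : smooth_on W w.
      apply: smoothM => //; apply: smoothX => //; apply: smoothB => //.
      exact: smooth_cst.
    have Pw k : iter k (Psi_op r s) w x = if k == j then h x * (j`!)%:R else 0.
      have := @iter_psi_conj K W r s r0 W setT h psi (fun z => (z - c) ^+ j) k oW
        (@subset_refl _ W) openT sh spsiW (fun _ _ => I) (@smooth_monomial K setT c j).
      move=> /(_ _ _ x Wx) ->.
      - by rewrite dn_monomial_at; case: eqP; rewrite ?mulr0.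
      - by move=> t Wt; rewrite /Psi_op h1 //; field; rewrite r0.
      - by move=> t _; rewrite invrK.
    have := expC W w x oW (@subset_refl _ W) sw Wx.
    have QM k l : derive1n k (fun t => Q t l q * w t) x
        = derive1n k (fun t => (psi t - c) ^+ j * M t l q) x.
      apply: (dn_ext k oW _ Wx) => t Wt; rewrite mxE /w.
      by field; exact: h0.
    rewrite QM (eq_bigr (fun k => \sum_l
      B k x i l * derive1n (n - k) (fun t => (psi t - c) ^+ j * M t l q) x)); last first.
      by move=> k _; apply: eq_bigr => l _; rewrite QM.
    rewrite sol //; last exact: WV.
    have jin : j \in index_iota 0 n.+1 by rewrite mem_index_iota /= ltnS ltnW.
    rewrite (bigD1_seq j jin (iota_uniq _ _)) /=.
    rewrite big1 ?addr0; last by move=> k kj; rewrite Pw (negbTE kj) mulr0.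
    move=> /esym/eqP; rewrite Pw eqxx !mulf_eq0 (negbTE (h0 x Wx)).
    by rewrite (negbTE (fact_neq0 K j)) !orbF => /eqP.
  move=> U' w oU' sU sw x Ux; rewrite (expC U') // big_nat_recr //= big_nat big1.
    by rewrite add0r Cn; [ring|exact: sU].
  by move=> j /andP[_ jn]; rewrite Cj ?mul0r //; exact: sU.
exists W, A, a; split => //; last first.
  by exists r, s, kap; split.
exists Q; split => //.
- by apply: smooth_mx.
- by move=> x Wx; rewrite unitmxZ ?uM ?unitfE ?invr_eq0 ?h0 //; exact: WV.
- move=> x Wx; apply/matrixP => i q.
  have sw := @smooth_monomial K W x n.-1.
  have := col i q W _ oW (@subset_refl _ W) sw x Wx.
  have nE : n = n.-1.+1 by rewrite prednK // (ltn_trans _ n2).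
  have n1 : (1 < n.+1)%N by rewrite ltnS ltnW.
  have P0 : iter n (Psi_op r s) (fun t => (t - x) ^+ n.-1) x = 0.
    rewrite (Hk W _ oW (@subset_refl _ W) sw x Wx) big_nat big1 // => j _.
    rewrite dn_monomial_at; have [->|j1] := eqVneq j 1%N.
      by rewrite k10 // mul0r.
    rewrite ifF ?mulr0 //; apply/negbTE; apply: contraNneq j1.
    case: j => [|[//|j]]; first by rewrite subn0 {1}nE => /eqP; rewrite gtn_eqF.
    move=> /eqP; rewrite {1}nE subSS ltn_eqF // ltn_subrL /=.
    by rewrite -ltnS -nE.
  rewrite P0 mul0r mulr0 (big_ltn n1) big_nat.
  rewrite [X in _ + (_ + X) = _]big1 ?addr0; last first.
    move=> k /andP[k2 kn]; rewrite big1 // => l _.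
    have [D0 _ _] := @dn_mul_monomial K W (fun t => Q t l q) x n.-1 oW (sQ l q) Wx.
    rewrite D0 ?mulr0 // {1}nE.
    case: k k2 kn => [//|k] k2 kn; rewrite subSS ltn_subrL; apply/andP; split => //.
    by rewrite -ltnS -nE.
  have [_ _] := @dn_mul_monomial K W (fun t => Q t i q) x n.-1 oW (sQ i q) Wx.
  rewrite -nE => ->.
  rewrite (eq_bigr (fun l => B 1%N x i l * Q x l q * (n.-1`!)%:R)); last first.
    move=> l _; have [_ D1 _] := @dn_mul_monomial K W (fun t => Q t l q) x n.-1 oW (sQ l q) Wx.
    by rewrite subn1 D1 mulrA.
  rewrite -mulr_suml -mulrDl => /eqP; rewrite mulf_eq0 (negbTE (fact_neq0 K _)) orbF.
  move=> /eqP H; rewrite !mxE addrC -[RHS]H; congr (_ + _).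
  congr (_ * _); apply: entry_d1.
  exact: smooth_diff (smooth_mx oW sQ) Wx.
move=> U' w oU' sU sw x Ux; apply/matrixP => i j; rewrite ord1 {j}.
have swl l := smooth_entry oU' l 0 sw.
have sQw l : smooth_on U' (fun t => (Q t *m w t) l 0).
  apply: (@smooth_ext _ _ _ oU' _ (fun t => \sum_q Q t l q * w t q 0)).
    by move=> t _; rewrite mxE.
  apply: smooth_sum => // q; apply: smoothM => //; exact: smooth_sub sU (sQ l q).
have sQwM : smooth_on U' (fun t => Q t *m w t).
  by apply: smooth_mx => // l k; rewrite ord1; exact: sQw.
rewrite (lin_op_entry n B i oU' sQwM Ux) mxE.
have dnQ k l : derive1n k (fun t => (Q t *m w t) l 0) x
    = \sum_q derive1n k (fun t => Q t l q * w t q 0) x.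
  rewrite -(@dn_sum K U') //.
    by apply: (dn_ext k oU' _ Ux) => t _; rewrite mxE.
  by move=> q; apply: smoothM => //; exact: smooth_sub sU (sQ l q).
rewrite dnQ (eq_bigr (fun k => \sum_q \sum_l B k x i l
   * derive1n (n - k) (fun t => Q t l q * w t q 0) x)); last first.
  move=> k _; rewrite exchange_big /=; apply: eq_bigr => l _.
  by rewrite dnQ mulr_sumr.
rewrite exchange_big /= -big_split /=; apply: eq_bigr => q _.
rewrite (col i q U' (fun t => w t q 0)) //.
by rewrite (lin_op_iterative n2 oW sr ss r0 Hk k10 ak A1 Ak oU' sU sw Ux).
Qed.

End NormalForm.

(** * Linearising a point transformation *)

Section Necessity.
Variables (K : numFieldType) (HK : geometrically_complete K) (m n : nat).
Hypothesis n2 : (2 <= n)%N.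
Local Notation E := (K * 'cV[K]_m)%type.

Lemma unitmx_ker0 (A : 'M[K]_m) :
  (forall u : 'cV[K]_m, A *m u = 0 -> u = 0) -> A \in unitmx.
Proof.
move=> inj; rewrite -unitmx_tr -row_free_unit; apply: inj_row_free => v vA.
have /inj H : A *m v^T = 0 by rewrite -[A]trmxK -trmx_mul vA trmx0.
by rewrite -[v]trmxK H trmx0.
Qed.

Lemma derive1_line (V : normedModType K) (G : V -> K) (a v : V) t :
  derive1 (fun t => G (a + t *: v)) t = 'D_v G (a + t *: v).
Proof.
rewrite /derive1 /derive; set d := (fun _ : K => _); set d' := (fun _ : K => _).
suff -> : d = d' by []; apply/funext => h; rewrite /d /d' /=.
by congr (_ *: (G _ - _)); rewrite scalerDl addrCA.
Qed.

Lemma derive_scale_dir (V W : normedModType K) (G : V -> W) (a v : V) (k : K) :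
  differentiable G a -> 'D_(k *: v) G a = k *: 'D_v G a.
Proof. by move=> dG; rewrite !deriveE // linearZ. Qed.

Lemma differential_of_inverse (V : normedModType K) (O O' : set V) (f g : V -> V) p :
  open O -> O p -> smooth_on O f -> smooth_on O' g -> (forall x, O x -> O' (f x)) ->
  (forall x, O x -> g (f x) = x) -> forall v, 'D_('D_v f p) g (f p) = v.
Proof.
move=> oO Op sf sg fO gf v.
have df := smooth_diff sf Op; have dg := smooth_diff sg (fO p Op).
have : 'D_v (g \o f) p = v.
  rewrite -[RHS](derive_id p v); apply: near_eq_derive.
  exact: (eq_on_near oO Op gf).
rewrite deriveE; last exact: differentiable_comp.
by rewrite diff_comp // => H; rewrite !deriveE.
Qed.

(** M u is the derivative of Phi in the fibre direction u along a line,
    corrected for the displacement of the independent variable so as to be taken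
    at fixed x.  The correction subtracts a multiple of the derivative of Phi
    along the line itself, which is not vertical; so M u = 0 forces u = 0 by
    injectivity of the differential of Phi. *)
Lemma reducible_power_solutions (D : set K) (B : nat -> K -> 'M[K]_m) x0 : open D ->
  (forall k, (1 <= k <= n)%N -> smooth_on D (B k)) -> reducible_at n D B x0 ->
  exists (V : set K) (psi : K -> K) (M : K -> 'M[K]_m),
  [/\ [/\ open V, V x0 & V `<=` D],
      smooth_on V psi /\ (forall x, V x -> derive1 psi x != 0),
      forall i j, smooth_on V (fun x => M x i j),
      forall x, V x -> M x \in unitmx &
      forall c i q, (i < n)%N -> forall x, V x -> forall j,
        derive1n n (fun t => (psi t - c) ^+ i * M t j q) x +
        \sum_(1 <= k < n.+1) \sum_l
          B k x j l * derive1n (n - k) (fun t => (psi t - c) ^+ i * M t l q) x = 0].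
Proof.
move=> oD sB [Om [Om' [Phi [Phi' [[[oOm oOm' sPhi sPhi'] [PO PO' PK PK']] OmD]]]]].
move=> [y0 Omy0] tr.
pose F (p : E) : K := (Phi p).1; pose T j (p : E) : K := (Phi p).2 j 0.
have sF : smooth_on Om F by exact: smooth_fst.
have sT j : smooth_on Om (T j) by apply: smooth_entry => //; exact: smooth_snd.
have dPhi p : Om p -> differentiable Phi p by exact: smooth_diff.
have DF p v : Om p -> 'D_v F p = ('D_v Phi p).1.
  move=> Op.
  exact: (@derive_linear K _ _ _ (@fst K 'cV[K]_m : {linear E -> K}) Phi p v
    (fun x => cvg_fst) (dPhi p Op)).
have DT j p v : Om p -> 'D_v (T j) p = ('D_v Phi p).2 j 0.
  move=> Op.
  have d2 : differentiable (fun p => (Phi p).2) p.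
    exact: (smooth_diff (smooth_snd oOm sPhi) Op).
  rewrite (@derive_linear K _ _ _ (entry j 0) (fun p => (Phi p).2) p v
    (@coord_continuous K m 1 j 0) d2).
  congr (entry j 0 _).
  exact: (@derive_linear K _ _ _ (@snd K 'cV[K]_m : {linear E -> 'cV[K]_m}) Phi p v
    (fun x => cvg_snd) (dPhi p Op)).
have injD p v : Om p -> 'D_v Phi p = 0 -> v = 0.
  move=> Op v0; rewrite -(differential_of_inverse oOm Op sPhi sPhi' PO PK v) v0.
  exact: derive0.
pose p0 := Phi' (x0, y0).
have Op0 : Om p0 by exact: PO'.
have Pp0 : Phi p0 = (x0, y0) by exact: PK'.
(* A direction over which the new independent variable is not stationary. *)
have [w1 w1P] : exists w1 : 'cV[K]_m, 'D_((1, w1) : E) F p0 != 0.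
  pose ab := 'D_((1, 0) : E) Phi' (x0, y0).
  have abP : 'D_ab Phi p0 = ((1, 0) : E).
    exact: (@differential_of_inverse _ Om' Om Phi' Phi (x0, y0) oOm' Omy0 sPhi' sPhi
      PO' PK' (1, 0)).
  have [H0|] := eqVneq ('D_((1, 0) : E) F p0) 0; last by exists 0.
  exists ab.2; have dF := smooth_diff sF Op0.
  have E1 : ((1, ab.2) : E) = (1 - ab.1) *: ((1, 0) : E) + ab.
    rewrite {2}[ab]surjective_pairing; apply: injective_projections => /=.
      by rewrite [X in _ = X + _]mulr1 subrK.
    by rewrite scaler0 add0r.
  rewrite E1 deriveE // linearD linearZ -!deriveE // H0 [X in X + _]mulr0 add0r DF // abP.
  exact: oner_neq0.
(* The line z |-> g0 z = (z, w0 + (z - z0) w1) through p0, in affine form. *)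
pose v1 : E := (1, w1); pose a0 : E := p0 - p0.1 *: v1.
pose v2 q : E := (0, delta_mx q 0).
pose g0 z : E := a0 + z *: v1.
have g00 : g0 p0.1 = p0 by rewrite /g0 /a0 subrK.
have fst_g0 z : (g0 z).1 = z.
  by rewrite /g0 /a0 /= ![_%:A]mulr1 subrr add0r.
have sg0 X : smooth_on X g0.
  apply: (@smooth_sub _ _ setT) => //; apply: smoothD; first exact: openT.
    exact: smooth_cst.
  by apply: smoothZl; [exact: openT|exact: smooth_id].
pose S0 := [set z | Om (g0 z)].
have oS0 : open S0.
  by apply: open_comp => // z _; exact: (smooth_cont (sg0 setT) I).
have FE := framep (@frameK K) (@frameM K m 1).
have on0 (G : E -> K) : smooth_on Om G -> smooth_on S0 (fun z => G (g0 z)).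
  exact: (@smooth_comp _ _ S0 oS0 _ _ FE frameK Om g0 G oOm (fun z h => h) (sg0 S0)).
pose phi0 z := F (g0 z).
have sphi0 : smooth_on S0 phi0 by exact: on0.
have S0z : S0 p0.1 by rewrite /S0 /= g00.
have d_line (G : E -> K) z : derive1 (fun z => G (g0 z)) z = 'D_v1 G (g0 z).
  exact: derive1_line.
have phi00 : derive1 phi0 p0.1 != 0 by rewrite /phi0 d_line g00.
have [A [V [psi [[oA Az AS] [oV Vx spsi] [phiA psiA psiK phiK] phi1 psi1]]]] :=
  local_inverse HK oS0 sphi0 S0z phi00.
have x0E : phi0 p0.1 = x0 by rewrite /phi0 g00 /F Pp0.
pose P z : 'M[K]_m := \matrix_(j, q) ('D_(v2 q) (T j) (g0 z)
  - derive1 (fun z => T j (g0 z)) z / derive1 phi0 z * 'D_(v2 q) F (g0 z)).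
have sPA j q : smooth_on A (fun z => P z j q).
  apply: (@smooth_ext _ _ _ oA _ (fun z => 'D_(v2 q) (T j) (g0 z)
    - derive1 (fun z => T j (g0 z)) z / derive1 phi0 z * 'D_(v2 q) F (g0 z))).
    by move=> z _; rewrite mxE.
  have sub (g : K -> K) : smooth_on S0 g -> smooth_on A g by exact: smooth_sub.
  apply: smoothB => //.
    exact: sub (on0 ('D_(v2 q) (T j)) (smooth_derive (v2 q) (sT j))).
  apply: smoothM => //; last first.
    exact: sub (on0 ('D_(v2 q) F) (smooth_derive (v2 q) sF)).
  apply: smoothM => //; first exact: sub (smooth_d1 oS0 (on0 (T j) (sT j))).
  by apply: smoothV => //; exact: sub (smooth_d1 oS0 sphi0).
have VD x : V x -> D x.
  by move=> Vx'; rewrite -(phiK x Vx'); apply: OmD; apply: PO; apply: AS; exact: psiA.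
exists V, psi, (fun x => P (psi x)); split.
- by split => //; rewrite -x0E.
- split; first exact: spsi.
  move=> x Vx'; rewrite (psi1 x Vx'); apply: invr_neq0; apply: phi1; exact: psiA.
- move=> i j; exact: (@smooth_comp _ _ V oV _ _ frameK frameK A psi _ oA psiA spsi (sPA i j)).
- move=> x Vx'; have Az1 := psiA x Vx'; set z := psi x in Az1 *.
  have Oz : Om (g0 z) := AS z Az1.
  apply: unitmx_ker0 => u Pu.
  pose v : E := (0, u).
  have vE : v = \sum_q u q 0 *: v2 q.
    apply: injective_projections; rewrite ?raddf_sum /=.
      by rewrite big1 // => q _; rewrite scaler0.
    rewrite [LHS]matrix_sum_delta; apply: eq_bigr => q _.
    by rewrite big_ord1.
  have DvG (G : E -> K) : smooth_on Om G ->
      'D_v G (g0 z) = \sum_q u q 0 * 'D_(v2 q) G (g0 z).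
    move=> sG; have dG := smooth_diff sG Oz.
    rewrite deriveE // vE linear_sum; apply: eq_bigr => q _.
    by rewrite linearZ -deriveE.
  have F1 : 'D_v1 F (g0 z) != 0 by rewrite -d_line; exact: phi1.
  pose lam := 'D_v F (g0 z) / 'D_v1 F (g0 z).
  have TjE j : 'D_v (T j) (g0 z) = lam * 'D_v1 (T j) (g0 z).
    have := congr1 (fun M : 'cV[K]_m => M j 0) Pu; rewrite !mxE => H.
    apply/eqP; rewrite -subr_eq0 -[X in _ == X]H; apply/eqP.
    rewrite /lam !DvG // mulr_suml mulr_suml -sumrB; apply: eq_bigr => q _.
    have -> : P z j q = 'D_(v2 q) (T j) (g0 z)
        - 'D_v1 (T j) (g0 z) / 'D_v1 F (g0 z) * 'D_(v2 q) F (g0 z).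
      by rewrite mxE !d_line.
    move: ('D_(v2 q) (T j) (g0 z)) ('D_v1 (T j) (g0 z)) ('D_v1 F (g0 z)).
    by move: ('D_(v2 q) F (g0 z)) => *; ring.
  have d0 : 'D_(v - lam *: v1) Phi (g0 z) = 0.
    have dz := dPhi _ Oz.
    have E1 : 'D_(v - lam *: v1) Phi (g0 z)
        = 'D_v Phi (g0 z) - lam *: 'D_v1 Phi (g0 z).
      by rewrite !deriveE // linearB linearZ.
    rewrite E1; apply: injective_projections => /=.
      rewrite -(DF (g0 z) v Oz) -(DF (g0 z) v1 Oz) [_ *: _]divfK //.
      exact: subrr.
    apply/matrixP => j k; rewrite ord1 !mxE {k}.
    apply/eqP; rewrite subr_eq0; apply/eqP.
    have := TjE j; rewrite (DT j _ v Oz) (DT j _ v1 Oz); exact.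
  have /(congr1 fst) /= := injD _ _ Oz d0.
  rewrite [_%:A]mulr1 sub0r => /eqP; rewrite oppr_eq0 => /eqP lam0.
  have := injD _ _ Oz d0; rewrite lam0 scale0r subr0 => /(congr1 snd) /= ->.
  by [].
move=> c i q i_n.
(* The line disturbed by e (z - c) ^ i in the fibre direction q. *)
pose gam (p : K * K) : E := g0 p.1 + (p.2 * (p.1 - c) ^+ i) *: v2 q.
have gam0 z : gam (z, 0) = g0 z by rewrite /gam mul0r scale0r addr0.
have gam1 p : (gam p).1 = p.1.
  by rewrite /gam -[LHS]/((g0 p.1).1 + _ * 0) mulr0 addr0.
have sgam X : smooth_on X gam.
  apply: (@smooth_sub _ _ setT) => //; have oT := @openT (K * K)%type.
  apply: smoothD => //.
    exact: (@smooth_comp _ _ setT oT _ _ frameK FE setT _ g0 openT _ (@smooth_on_fst _ K K setT) (sg0 _)).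
  apply: smoothZl => //; apply: smoothM => //; first exact: smooth_on_snd.
  apply: smoothX => //; apply: smoothB => //; last exact: smooth_cst.
  exact: smooth_on_fst.
pose G := [set p | Om (gam p)].
have oG : open G by apply: open_comp => // p _; exact: (smooth_cont (sgam setT) I).
have onG (H : E -> K) : smooth_on Om H -> smooth_on G (fun p => H (gam p)).
  exact: (@smooth_comp _ _ G oG _ _ FE frameK Om gam H oOm (fun z h => h) (sgam G)).
pose phi p := F (gam p); pose Y j p := T j (gam p).
have sphiG : smooth_on G phi by exact: onG.
pose U := [set p | G p /\ [set x : K | x != 0] (d_z phi p)].
have sdz : smooth_on G (d_z phi) by exact: smooth_derive.
have oU : open U.
  by apply: open_preimage; [exact: oG|exact: open_neq0|move=> p Gp; exact: smooth_cont Gp].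
have UG : U `<=` G by move=> p [].
have sphi := smooth_sub UG sphiG.
have sY j : smooth_on U (Y j) by apply: (smooth_sub UG); exact: onG.
have U0 p : U p -> d_z phi p != 0 by move=> [].
have UD p : U p -> D (phi p) by move=> /UG Gp; apply: OmD; exact: PO.
have sb k j l : (1 <= k <= n)%N -> smooth_on D (fun x => B k x j l).
  by move=> /sB; exact: smooth_entry.
have slice_smooth (X : set K) (g : K * K -> K) e : open X ->
    (forall z, X z -> U (z, e)) -> smooth_on U g -> smooth_on X (fun z => g (z, e)).
  move=> oX XU sg.
  have sp : smooth_on X (fun z : K => (z, e)).
    by apply: (smooth_pair oX frameK frameK); [exact: smooth_id|exact: smooth_cst].
  exact: (@smooth_comp _ _ X oX _ _ (framep frameK frameK) frameK U _ g oU XU sp sg).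
(* The members of the family solve w^(n) = 0 since i < n and n >= 2, and the
   image of each, near any of its points, is the graph of a solution. *)
have eqn j p : U p -> iter n (along_x phi) (Y j) p +
    \sum_(1 <= k < n.+1) \sum_l B k (phi p) j l * iter (n - k) (along_x phi) (Y l) p = 0.
  case: p => z1 e Up.
  pose S := [set z : K | U (z, e)].
  have cpair (z : K) : {for z, continuous (fun z : K => (z, e))}.
    by apply: differentiable_continuous; exact: differentiable_pair.
  have oS : open S by apply: open_comp => // z _; exact: cpair.
  have sS : smooth_on S (fun z => phi (z, e)) by exact: slice_smooth.
  have [|A1 [V1 [ps1 [[oA1 A1z A1S] [oV1 V1x sps1] [phiA1 psA1 ps1K phi1K] _ dps1]]]] :=
    local_inverse HK oS sS (Up : S z1).
    by rewrite derive1_fst; exact: U0 Up.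
  pose w z := (gam (z, e)).2; pose y x := (Phi (gam (ps1 x, e))).2.
  have gw z : (z, w z) = gam (z, e).
    by rewrite [RHS]surjective_pairing gam1.
  have spair X : smooth_on X (fun z : K => (z, e)).
    apply: (@smooth_sub _ _ setT) => //.
    by apply: (smooth_pair openT frameK frameK); [exact: smooth_id|exact: smooth_cst].
  have sw : smooth_on A1 w.
    apply: (smooth_snd oA1 (f := fun z => gam (z, e))).
    exact: (@smooth_comp _ _ A1 oA1 _ _ (framep frameK frameK) FE setT _ gam openT
      (fun _ _ => I) (spair A1) (sgam setT)).
  have sy : smooth_on V1 y.
    apply: smooth_mx => // l k; rewrite ord1.
    have sYA : smooth_on A1 (fun z => Y l (z, e)).
      by apply: slice_smooth => // z /A1S.
    exact: (@smooth_comp _ _ V1 oV1 _ _ frameK frameK A1 ps1 _ oA1 psA1 sps1 sYA).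
  have gOm : graph A1 w `<=` Om.
    by move=> _ [z /A1S /UG Gz <-]; rewrite gw.
  have gE : Phi @` graph A1 w = graph V1 y.
    apply/seteqP; split.
      move=> _ [_ [z Az1 <-] <-]; exists (phi (z, e)); first exact: phiA1.
      by rewrite gw /y ps1K // [RHS]surjective_pairing.
    move=> _ [x Vx1 <-]; exists (ps1 x, w (ps1 x)).
      by exists (ps1 x) => //; exact: psA1.
    by rewrite gw [LHS]surjective_pairing -[(Phi _).1]/(phi (ps1 x, e)) phi1K.
  have solw : solves n (fun _ _ => 0 : 'M[K]_m) A1 w.
    move=> z Az1; rewrite lin_op0; apply/matrixP => l k; rewrite ord1 {k}.
    rewrite (entry_dn n l 0 oA1 sw Az1) mxE.
    have wE t : w t l 0 = a0.2 l 0 * (t - 0) ^+ 0 + (w1 l 0 * (t - 0) ^+ 1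
       + (e * (v2 q).2 l 0) * (t - c) ^+ i).
      rewrite /w /gam /g0 /= !mxE; ring.
    have sm (b : K) j' c' : smooth_on setT (fun t : K => b * (t - c') ^+ j').
      by apply: smoothM; [exact: openT|exact: smooth_cst|exact: smooth_monomial].
    have dn0 (b : K) j' c' : (j' < n)%N ->
        derive1n n (fun t : K => b * (t - c') ^+ j') z = 0.
      move=> jn; rewrite (@dn_scale K setT) //; [|exact: openT|exact: smooth_monomial].
      by rewrite dn_monomial ffact_small // mul0r mulr0.
    rewrite (@dn_ext K K setT _ _ n openT (fun t _ => wE t) z I).
    have sm2 := smoothD openT (sm (w1 l 0) 1%N 0) (sm (e * (v2 q).2 l 0) i c).
    rewrite (dn_add n openT (sm _ 0%N 0) sm2 I).
    rewrite (dn_add n openT (sm _ 1%N 0) (sm _ i c) I).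
    have n0 : (0 < n)%N by exact: leq_trans n2.
    by rewrite !dn0 // !add0r.
  have := (tr A1 V1 w y oA1 oV1 sw sy gOm gE).2 solw _ V1x.
  move=> /(congr1 (fun M : 'cV[K]_m => M j 0)).
  rewrite [RHS]mxE (lin_op_entry n B j oV1 sy V1x).
  have sl k l : derive1n k (fun t => y t l 0) (phi (z1, e))
      = iter k (along_x phi) (Y l) (z1, e).
    have := @dn_slice K U phi oU sphi U0 V1 ps1 e (Y l) k oV1 sps1.
    move=> /(_ (fun x Vx1 => A1S _ (psA1 x Vx1)) dps1 (sY l) _ V1x).
    by rewrite ps1K.
  move=> H; rewrite -[RHS]H sl; congr (_ + _); apply: eq_bigr => k _.
  by apply: eq_bigr => l _; rewrite sl.
have var := variation_solves HK oU sphi U0 oD sb UD sY eqn.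
move=> x Vx' j.
have phiE : (fun z => phi (z, 0)) = phi0 by apply/funext => z; rewrite /phi gam0.
have YE l : (fun z => Y l (z, 0)) = fun z => T l (g0 z).
  by apply/funext => z; rewrite /Y gam0.
have UA z : A z -> U (z, 0).
  move=> Az1; split; first by rewrite /G /= gam0; exact: AS.
  by rewrite /= /d_z -derive1_fst phiE; exact: phi1.
have dE (H : E -> K) z : smooth_on Om H -> A z ->
    d_e (fun p => H (gam p)) (z, 0) = (z - c) ^+ i * 'D_(v2 q) H (g0 z).
  move=> sH Az1; rewrite /d_e -derive1_snd.
  have -> : (fun t => H (gam (z, t))) = fun t => H (g0 z + t *: ((z - c) ^+ i *: v2 q)).
    by apply/funext => t; rewrite /gam scalerA.
  rewrite derive1_line scale0r addr0 derive_scale_dir //.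
  exact: smooth_diff sH (AS z Az1).
have aE l z : A z -> along_e phi (Y l) (z, 0) = (z - c) ^+ i * P z l q.
  move=> Az1; rewrite /along_e /along_x (dE (T l) z (sT l) Az1) (dE F z sF Az1).
  rewrite /d_z -!derive1_fst phiE YE mxE; ring.
have sl k l : derive1n k (fun t => (psi t - c) ^+ i * P (psi t) l q) x
    = iter k (along_x phi) (along_e phi (Y l)) (psi x, 0).
  rewrite -(@dn_slice K U phi oU sphi U0 V psi 0 _ k oV spsi) //.
  - by apply: (dn_ext k oV _ Vx') => t Vt; rewrite aE //; exact: psiA.
  - by move=> t Vt; apply: UA; exact: psiA.
  - by move=> t Vt; rewrite phiE psi1.
  - exact: smooth_along_e.
have := var j _ (UA _ (psiA _ Vx')).
rewrite -[phi (psi x, 0)]/((fun z => phi (z, 0)) (psi x)) phiE phiK // => H.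
rewrite -[RHS]H sl; congr (_ + _); apply: eq_bigr => k _.
by apply: eq_bigr => l _; rewrite sl.
Qed.

End Necessity.

Theorem theorem2 (K : numFieldType) (hK : real_or_complex K)
  (m n : nat) (hm : (1 <= m)%N) (hn : (2 <= n)%N)
  (D : set K) (hD : open D)
  (B : nat -> K -> 'M[K]_m)
  (hB : forall k, (1 <= k <= n)%N -> smooth_on D (B k))
  (x0 : K) (hx0 : D x0) :
  reducible_at n D B x0 <->
  exists (U : set K) (A : nat -> K -> 'M[K]_m) (a : nat -> K -> K),
    [/\ [/\ open U, U x0 & U `<=` D],
        normal_form_on n U B A,
        forall k, (2 <= k <= n)%N -> forall x, U x -> A k x = (a k x)%:M &
        iterative_on n U a].
Proof.
have HK := real_or_complex_complete hK; split; last first.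
  move=> [U [A [a [[oU Ux0 UD] nf Aa itU]]]].
  exact: (normal_form_reducible HK hn oU Ux0 UD nf Aa itU).
move=> red.
have [V [psi [M [[oV Vx0 VD] [spsi psi0] sM uM sol]]]] :=
  reducible_power_solutions HK hn hD hB red.
have [U [A [a [[oU Ux0 UV] nf Aa itU]]]] :=
  power_solutions_normal_form HK hn oV Vx0 spsi psi0 sM uM sol.
by exists U, A, a; split => //; split => // x /UV /VD.
Qed.
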